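(* Let $\tilde G$ and $G$ be (complete) normed Abelian groups and let $\phi:\tilde G\to G$ be a surjective homomorphism such that, for some constant $C>0$, $\|\phi(\tilde g)\|_G\le C\|\tilde g\|_{\tilde G}$ for every $\tilde g\in\tilde G$, and $\|g\|_G\ge C^{-1}\inf_{\tilde g\in\phi^{-1}(g)}\|\tilde g\|_{\tilde G}$ for every $g\in G$. Let $K\subset\mathbb{R}^d$ be a convex, compact set with nonempty interior and let $\pi:\mathscr{F}_d^{\tilde G}(K)\to\mathscr{F}_d^G(K)$ be the map induced by $\phi$. Then the restriction of $\pi$ is surjective between $\{\tilde T\in\mathscr{F}_d^{\tilde G}(K):\mathbb{M}(\tilde T)<\infty\}$ and $\{T\in\mathscr{F}_d^G(K):\mathbb{M}(T)<\infty\}$.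
   Context: Normed group: an Abelian group $(G,+)$ with $\|\cdot\|:G\to\mathbb{R}$ such that $\|g\|\ge0$ with equality iff $g=0$, $\|-g\|=\|g\|$, $\|g+h\|\le\|g\|+\|h\|$; groups are assumed complete for the metric $\|g-h\|$. Polyhedral chains: $\mathscr{P}_k^G(K)$ is the group of finite formal sums $P=\sum_{\ell=1}^N g_\ell\llbracket\sigma_\ell\rrbracket$, with $g_\ell\in G$ and $\sigma_\ell\subset K$ non-overlapping oriented $k$-simplexes, identified when they have a common refinement (reversing orientation changes $g_\ell$ to $-g_\ell$). Mass: $\mathbb{M}(P)=\sum_\ell\|g_\ell\|\mathcal{H}^k(\sigma_\ell)$. Boundary: $\partial P=\sum_\ell g_\ell\,\partial\llbracket\sigma_\ell\rrbracket$. Flat norm: $\mathbb{F}(P)=\inf\{\mathbb{M}(Q)+\mathbb{M}(P-\partial Q): Q\in\mathscr{P}_{k+1}^G(K)\}$. Flat chains: $\mathscr{F}_k^G(K)$ is the $\mathbb{F}$-completion of $\mathscr{P}_k^G(K)$; mass extends by relaxation, $\mathbb{M}(T)=\inf\{\liminf_n\mathbb{M}(P_n): P_n\in\mathscr{P}_k^G(K),\ \mathbb{F}(P_n-T)\to0\}$. Induced map: on polyhedral chains $\pi(\sum_i\tilde g_i\llbracket\sigma_i\rrbracket):=\sum_i\phi(\tilde g_i)\llbracket\sigma_i\rrbracket$; it commutes with $\partial$, satisfies $\mathbb{F}(\pi(P))\le C\,\mathbb{F}(P)$ and hence extends to a $C$-Lipschitz map $\pi:\mathscr{F}_k^{\tilde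 G}(K)\to\mathscr{F}_k^G(K)$ for the flat norms. *)

(* Defs.v *)
From HB Require Import structures.
From mathcomp Require Import all_boot all_order all_algebra.
From mathcomp Require Import all_classical all_reals all_analysis.

Set Implicit Arguments.
Unset Strict Implicit.
Unset Printing Implicit Defensive.

Import Order.TTheory GRing.Theory Num.Theory.
Import numFieldNormedType.Exports.

Local Open Scope classical_set_scope.
Local Open Scope ring_scope.

(* Complete normed Abelian groups.  [normedZmodType] is not suitable: it      *)
(* requires |x *+ n| = |x| *+ n, which excludes groups with torsion.          *)
Record normedGroup (R : realType) := NormedGroup {
  ng_sort :> zmodType;
  ng_norm : ng_sort -> R;
  ng_norm_ge0 : forall g, 0 <= ng_norm g;
  ng_norm_eq0 : forall g, ng_norm g = 0 <-> g = 0;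
  ng_normN : forall g, ng_norm (- g) = ng_norm g;
  ng_normD : forall g h, ng_norm (g + h) <= ng_norm g + ng_norm h;
  ng_norm_complete : forall u : nat -> ng_sort,
    (forall e, 0 < e -> exists N, forall m n, (N <= m)%N -> (N <= n)%N ->
       ng_norm (u m - u n) < e) ->
    exists l, forall e, 0 < e -> exists N, forall n, (N <= n)%N ->
       ng_norm (u n - l) < e }.

Section Hausdorff.
Context {R : realType} {d : nat}.
Implicit Types (x y : 'rV[R]_d) (U A : set 'rV[R]_d) (k : nat).

(* The library norm of ['rV[R]_d] is the sup norm. *)
Definition enorm x : R := Num.sqrt (\sum_i x 0 i ^+ 2).

(* Equal to [-oo] on the empty set. *)
Definition diam U : \bar R :=
  ereal_sup [set z | exists x y, [/\ U x, U y & z = (enorm (x - y))%:E]].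

(* diam(U)^k, with the conventions diam(set0)^k = 0 (also for k = 0), and     *)
(* diam(U)^0 = 1 if U is nonempty.                                            *)
Definition diamX k U : \bar R := (if U == set0 then 0 else diam U ^+ k)%E.

(* Volume of the unit ball of R^k. *)
Fixpoint ball_volume k : R :=
  match k with
  | 0 => 1
  | 1 => 2
  | k'.+2 => 2 * pi / k%:R * ball_volume k'
  end.

Definition hausdorff_delta k (delta : R) A : \bar R :=
  ereal_inf [set z | exists U : nat -> set 'rV[R]_d,
    [/\ A `<=` \bigcup_i U i, (forall i, (diam (U i) <= delta%:E)%E) &
        z = (\sum_(0 <= i <oo) (ball_volume k / 2 ^+ k)%:E * diamX k (U i))%E]].

Definition hausdorff k A : \bar R :=
  ereal_sup [set hausdorff_delta k delta A | delta in [set e | 0 < e]].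

Lemma hausdorff_ge0 k A : (0 <= hausdorff k A)%E.
Proof.
have bv0 n : 0 <= ball_volume n.
  elim/ltn_ind: n => -[|[|n]] ih //.
  by rewrite /= mulr_ge0 ?ih// divr_ge0// mulr_ge0// pi_ge0.
apply: le_trans (ereal_sup_ubound _); last by exists 1; [exact: ltr01|].
apply: le_ereal_inf_tmp => _ [U [_ _ ->]].
apply: nneseries_ge0 => i _ _; apply: mule_ge0.
  by rewrite lee_fin divr_ge0// exprn_ge0.
rewrite /diamX; case: ifPn => // /set0P[x Ux].
have : (0 <= diam (U i))%E.
  apply: ereal_sup_ubound; exists x, x; split=> //.
  by rewrite subrr /enorm big1 ?sqrtr0// => j _; rewrite mxE expr0n.
exact: expe_ge0.
Qed.

End Hausdorff.

(* An ordered k-simplex is the matrix of its k.+1 vertices, as rows. *)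
Section Simplex.
Context {R : realType} {d k : nat}.
Implicit Types (sigma tau : 'M[R]_(k.+1, d)) (S : seq 'M[R]_(k.+1, d)).

Definition simplex_edges sigma : 'M[R]_(k, d) :=
  \matrix_(i < k) (row (lift ord0 i) sigma - row ord0 sigma).

Definition nondegenerate sigma := row_free (simplex_edges sigma).

Definition simplex_hull sigma : set 'rV[R]_d :=
  [set x | exists w : 'rV[R]_k.+1,
    [/\ forall i, 0 <= w 0 i, \sum_i w 0 i = 1 & x = w *m sigma]].

(* The relative interior of a nondegenerate simplex. *)
Definition simplex_interior sigma : set 'rV[R]_d :=
  [set x | exists w : 'rV[R]_k.+1,
    [/\ forall i, 0 < w 0 i, \sum_i w 0 i = 1 & x = w *m sigma]].

Definition nonoverlapping S :=
  trivIset [set i | (i < size S)%N] (fun i => simplex_interior (nth 0 S i)).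

(* For nondegenerate simplexes spanning the same affine k-plane, the edges of *)
(* tau are A *m edges of sigma with A invertible, and this determinant is     *)
(* \det A times the (positive) Gram determinant of sigma; for k = 0 it is 1.  *)
Definition same_orientation tau sigma : bool :=
  0 < \det (simplex_edges tau *m (simplex_edges sigma)^T).

End Simplex.

Section FormalSums.
Context {R : realType} {d : nat} {G : zmodType}.

(* Finite formal sums of g [[sigma]]; the simplexes may overlap here, so that *)
(* formal sums can be added by concatenation.                                 *)
Definition formal_sum (k : nat) := seq (G * 'M[R]_(k.+1, d)).

Definition fsub k (P Q : formal_sum k) : formal_sum k :=
  P ++ [seq (- t.1, t.2) | t <- Q].

Definition boundary k (P : formal_sum k.+1) : formal_sum k :=
  flatten [seq [seq ((if odd i then - t.1 else t.1), row' i t.2)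
                | i : 'I_k.+2] | t <- P].

(* The coefficient that P induces on a simplex tau of a refinement of P. *)
Definition coef k (P : formal_sum k) (tau : 'M[R]_(k.+1, d)) : G :=
  \sum_(t <- P | `[< simplex_hull tau `<=` simplex_hull t.2 >])
    (if same_orientation tau t.2 then t.1 else - t.1).

(* The simplexes of S subdivide each simplex of P.  Then P is refined into    *)
(* the sum of the (coef P tau) [[tau]], for tau in S.                         *)
Definition subdivides k (S : seq 'M[R]_(k.+1, d)) (P : formal_sum k) : Prop :=
  [/\ forall tau, tau \in S -> nondegenerate tau,
      nonoverlapping S &
      forall t, t \in P -> simplex_hull t.2 =
        \bigcup_(tau in [set tau | tau \in S /\
                          simplex_hull tau `<=` simplex_hull t.2])
          simplex_hull tau].

(* P and Q have a common refinement, up to simplexes with coefficient 0. *)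
Definition same_chain k (P Q : formal_sum k) : Prop :=
  exists S, [/\ subdivides S P, subdivides S Q &
                forall tau, tau \in S -> coef P tau = coef Q tau].

End FormalSums.
Arguments formal_sum {R} d G k.

Section Chains.
Context {R : realType} {d : nat} (K : set 'rV[R]_d) (G : normedGroup R).

(* Representatives of polyhedral chains: the chain is the class of the        *)
(* formal sum for [same_chain].                                               *)
Record polychain (k : nat) := Polychain {
  poly_sum :> formal_sum d G k;
  poly_simplex : forall t, t \in poly_sum ->
    nondegenerate t.2 /\ simplex_hull t.2 `<=` K;
  poly_nonoverlapping : nonoverlapping [seq t.2 | t <- poly_sum] }.

Definition poly_mass k (P : polychain k) : \bar R :=
  (\sum_(t <- poly_sum P) (ng_norm t.1)%:E * hausdorff k (simplex_hull t.2))%E.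

Lemma poly_mass_ge0 k (P : polychain k) : (0 <= poly_mass P)%E.
Proof.
by apply: sume_ge0 => t _; rewrite mule_ge0 ?hausdorff_ge0// lee_fin ng_norm_ge0.
Qed.

(* In M(Q) + M(P - \partial Q), the second mass is that of a polyhedral chain *)
(* S representing P - \partial Q.                                             *)
Definition flat_norm k (P : formal_sum d G k) : \bar R :=
  ereal_inf [set z | exists (Q : polychain k.+1) (S : polychain k),
    same_chain S (fsub P (boundary Q)) /\
    z = (poly_mass Q + poly_mass S)%E].

Definition flat_cauchy k (u : nat -> polychain k) : Prop :=
  forall e : R, 0 < e -> exists N, forall m n, (N <= m)%N -> (N <= n)%N ->
    (flat_norm (fsub (u m) (u n)) < e%:E)%E.

Definition flat_class k (u : nat -> polychain k) : set (nat -> polychain k) :=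
  [set v | flat_cauchy v /\
           (fun n => flat_norm (fsub (v n) (u n))) @ \oo --> 0%E].

(* The flat completion: classes of Cauchy sequences of polyhedral chains.     *)
(* Representatives of the same polyhedral chain are at flat distance 0, hence *)
(* are identified here.                                                       *)
Record flat_chain (k : nat) := FlatChain {
  flat_set :> set (nat -> polychain k);
  flat_setP : exists u, flat_cauchy u /\ flat_set = flat_class u }.

Definition flat_rep k (T : flat_chain k) : nat -> polychain k :=
  sval (cid (flat_setP T)).

Lemma flat_rep_cauchy k (T : flat_chain k) : flat_cauchy (flat_rep T).
Proof. by rewrite /flat_rep; case: cid => u []. Qed.

(* F(P - T); the upper limit is a limit. *)
Definition flat_dist k (P : polychain k) (T : flat_chain k) : \bar R :=
  limn_esup (fun n => flat_norm (fsub P (flat_rep T n))).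

Definition mass k (T : flat_chain k) : \bar R :=
  ereal_inf [set limn_einf (fun n => poly_mass (u n)) |
    u in [set u : nat -> polychain k |
           (fun n => flat_dist (u n) T) @ \oo --> 0%E]].

End Chains.
Arguments polychain {R d} K G k.
Arguments flat_chain {R d} K G k.

Section FormalMap.
Context {R : realType} {d : nat} {G' G : zmodType} (phi : {additive G' -> G}).

Definition formal_map k (P : formal_sum (R := R) d G' k) : formal_sum d G k :=
  [seq (phi t.1, t.2) | t <- P].

Lemma formal_map_fsub k (P Q : formal_sum d G' k) :
  formal_map (fsub P Q) = fsub (formal_map P) (formal_map Q).
Proof.
rewrite /formal_map /fsub map_cat -!map_comp; congr (_ ++ _).
by apply: eq_map => t /=; rewrite raddfN.
Qed.

Lemma formal_map_boundary k (P : formal_sum d G' k.+1) :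
  formal_map (boundary P) = boundary (formal_map P).
Proof.
rewrite /formal_map /boundary map_flatten -!map_comp; congr flatten.
apply: eq_map => t /=; rewrite -map_comp; apply: eq_map => i /=.
by case: odd => //; rewrite raddfN.
Qed.

Lemma coef_formal_map k (P : formal_sum d G' k) tau :
  coef (formal_map P) tau = phi (coef P tau).
Proof.
rewrite /coef /formal_map big_map raddf_sum; apply: eq_bigr => t _.
by case: ifP => //; rewrite raddfN.
Qed.

Lemma subdivides_formal_map k S (P : formal_sum d G' k) :
  subdivides S P -> subdivides S (formal_map P).
Proof.
by case=> S1 S2 S3; split=> // _ /mapP[t tP ->]; apply: (S3 t tP).
Qed.

Lemma same_chain_formal_map k (P Q : formal_sum d G' k) :
  same_chain P Q -> same_chain (formal_map P) (formal_map Q).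
Proof.
case=> S [SP SQ PQ]; exists S; split; try exact: subdivides_formal_map.
by move=> tau tauS; rewrite !coef_formal_map PQ.
Qed.

End FormalMap.

Section InducedMap.
Context {R : realType} {d : nat} (K : set 'rV[R]_d) (G' G : normedGroup R).
Context (phi : {additive G' -> G}).

Lemma poly_map_simplex k (P : polychain K G' k) t :
  t \in formal_map phi P -> nondegenerate t.2 /\ simplex_hull t.2 `<=` K.
Proof. by move=> /mapP[s sP ->]; exact: (poly_simplex sP). Qed.

Lemma poly_map_nonoverlapping k (P : polychain K G' k) :
  nonoverlapping [seq t.2 | t <- formal_map phi P].
Proof.
by rewrite /formal_map -map_comp -[map _ _]/(map snd _); exact: poly_nonoverlapping.
Qed.

Definition poly_map k (P : polychain K G' k) : polychain K G k :=
  Polychain (@poly_map_simplex k P) (@poly_map_nonoverlapping k P).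

Context (C : R) (C_gt0 : 0 < C).
Context (phi_le : forall g, ng_norm (phi g) <= C * ng_norm g).

Lemma poly_map_mass k (P : polychain K G' k) :
  (poly_mass (poly_map P) <= C%:E * poly_mass P)%E.
Proof.
rewrite /poly_mass /= /formal_map big_map ge0_sume_distrr; last first.
  by move=> t _; rewrite mule_ge0 ?hausdorff_ge0// lee_fin ng_norm_ge0.
apply: lee_sum => t _ /=; rewrite muleA -EFinM.
by apply: lee_wpmul2r; [exact: hausdorff_ge0|rewrite lee_fin].
Qed.

Lemma flat_norm_formal_map k (P : formal_sum d G' k) :
  (flat_norm K (formal_map phi P) <= C%:E * flat_norm K P)%E.
Proof.
rewrite -lee_pdivrMl//; apply: le_ereal_inf_tmp => _ [Q [S [QS ->]]].
rewrite lee_pdivrMl//.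
apply: (@le_trans _ _ (poly_mass (poly_map Q) + poly_mass (poly_map S))%E).
  apply: ereal_inf_lbound; exists (poly_map Q), (poly_map S); split=> //=.
  by rewrite -formal_map_boundary -formal_map_fsub; exact: same_chain_formal_map.
by rewrite ge0_muleDr ?poly_mass_ge0// leeD ?poly_map_mass.
Qed.

Lemma poly_map_cauchy k (u : nat -> polychain K G' k) :
  flat_cauchy u -> flat_cauchy (fun n => poly_map (u n)).
Proof.
move=> uC e e0; have Ce0 : 0 < C^-1 * e by rewrite mulr_gt0 ?invr_gt0.
have [N uN] := uC _ Ce0; exists N => m n Nm Nn.
have := flat_norm_formal_map (fsub (u m) (u n)).
rewrite formal_map_fsub => /le_lt_trans; apply.
by rewrite -lte_pdivlMl// -EFinM; exact: uN.
Qed.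

(* The C-Lipschitz extension of [poly_map] to flat chains; the class does not *)
(* depend on the chosen representative of T by [flat_norm_formal_map].        *)
Definition flat_map k (T : flat_chain K G' k) : flat_chain K G k :=
  FlatChain (ex_intro _ _ (conj (poly_map_cauchy (flat_rep_cauchy T)) erefl)).

End InducedMap.
Arguments flat_map {R d K G' G phi C} C_gt0 phi_le {k} T.

(* Main.v *)
(* In dimension d there are no nondegenerate (d+1)-simplexes, so the flat norm *)
(* of a polyhedral d-chain is the infimum of the masses of its representatives *)
(* and a flat chain is a limit of polyhedral chains in mass.  Hence a chain T  *)
(* is the sum of a series of polyhedral chains of geometrically decaying mass; *)
(* lifting each coefficient g to some g' over g with |g'| <= 2 C |g| gives a   *)
(* series of polyhedral chains over G' which still converges, to a lift of T.  *)
(*                                                                             *)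
(* Sums of polyhedral chains are represented without overlaps on a common      *)
(* refinement, obtained by bisecting edges until every piece lies on one side  *)
(* of all facet hyperplanes.  Mass does not increase in the process, because   *)
(* the Hausdorff measure is superadditive on nonoverlapping simplexes: shrunk  *)
(* towards their barycenters these are at positive distance from each other.   *)

From Pilot Require Import Defs.
From mathcomp Require Import all_boot all_order all_algebra.
From mathcomp Require Import all_classical all_reals all_analysis.
From mathcomp Require Import ring lra.
(* Restores [nondegenerate], which MathComp also uses for forms. *)
Import Pilot.Defs.

Set Implicit Arguments.
Unset Strict Implicit.
Unset Printing Implicit Defensive.

Import Order.TTheory GRing.Theory Num.Theory.
Import numFieldNormedType.Exports.

Local Open Scope classical_set_scope.
Local Open Scope ring_scope.

(** A polyhedral chain lifts at once, one coefficient at a time, with mass multiplied by at most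
    [2 * C] ([lift_exists], [polychain_lift]). The difficulty is that lifts of a convergent
    sequence, taken independently, need not converge. In top dimension this is cured by lifting
    increments. Since there are no polyhedral (d+1)-chains other than zero ([polychain_above_top]),
    a small flat norm means a representative of small mass ([flat_norm_lt]), and smallness of mass
    survives lifting.

    Given T of finite mass, [mass_ltyP] provides polyhedral chains [w n] of bounded mass within
    [(1 / 2) ^+ n.+1] of T. In [lift_sequence], [w 0] and every difference [w n.+1 - w n] are lifted
    and added up. The partial sums lie over the [w n], have bounded mass, and are Cauchy by
    comparison with a geometric series. Their limit has finite mass and is sent to T
    ([flat_map_surj]). Finite mass is preserved by the induced map because the map is Lipschitz for
    both mass and flat norm ([flat_map_mass]).

    The remaining work is geometric: chains must be added and compared without increasing mass.
    [common_refinement] cuts finitely many simplexes into common pieces, [same_chain_coef] makes the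
    comparison of two sums independent of the pieces, and [hausdorff_simplexes_le] bounds the total
    Hausdorff measure of the pieces of a simplex by that of the simplex. Together they give
    [polychain_exists], hence sums of chains and the triangle inequality for the flat distance. *)

(** * Barycentric coordinates and interiors of top-dimensional simplexes *)

Section Barycentric.
Context {R : realType} {d : nat}.
Implicit Types (x y : 'rV[R]_d).

(** Nondegeneracy as affine independence of the vertices. Weights of total zero are determined by
    those off vertex 0, and combine the vertices as these combine the edges. *)
Lemma nondegenerateP k (sigma : 'M[R]_(k.+1, d)) :
  nondegenerate sigma <->
  forall w : 'rV[R]_k.+1, \sum_i w 0 i = 0 -> w *m sigma = 0 -> w = 0.
Proof.
have E (w : 'rV[R]_k.+1) : \sum_i w 0 i = 0 ->
    w *m sigma = (\row_i w 0 (lift ord0 i)) *m simplex_edges sigma.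
  rewrite big_ord_recl => /eqP; rewrite addr_eq0 => /eqP w0.
  rewrite !mulmx_sum_row big_ord_recl w0 scaleNr scaler_suml -sumrN -big_split.
  apply: eq_bigr => i _ /=.
  by rewrite rowK mxE scalerBr addrC.
split=> [nd w w0 ws0|aff].
  have u0 : \row_i w 0 (lift ord0 i) = 0.
    by apply: (row_free_inj nd); rewrite mul0mx -E.
  have w1 i : w 0 (lift ord0 i) = 0 by move/rowP: u0 => /(_ i); rewrite !mxE.
  apply/rowP => i; rewrite [RHS]mxE; case: (unliftP ord0 i) => [j ->|->] //.
  by move: w0; rewrite big_ord_recl big1 ?addr0.
apply: inj_row_free => u u0.
pose w : 'rV[R]_k.+1 := \row_i if unlift ord0 i is Some j then u 0 j
                               else - \sum_j u 0 j.
have wl j : w 0 (lift ord0 j) = u 0 j by rewrite mxE liftK.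
have w0 : \sum_i w 0 i = 0.
  rewrite big_ord_recl [w 0 _]mxE unlift_none.
  by apply/eqP; rewrite addrC subr_eq0; apply/eqP/eq_bigr => j _; exact: wl.
have wE : \row_i w 0 (lift ord0 i) = u by apply/rowP => j; rewrite mxE wl.
have := aff w w0; rewrite E // wE => /(_ u0) wz.
by apply/rowP => j; rewrite -wl wz !mxE.
Qed.

Implicit Types (sigma tau : 'M[R]_(d.+1, d)).

(** Vertices in homogeneous coordinates: prescribing both a point and the total weight becomes one
    linear equation. *)
Definition homogeneous sigma : 'M[R]_(1 + d) :=
  row_mx (const_mx 1 : 'M[R]_(1 + d, 1)) (sigma : 'M[R]_(1 + d, d)).

Lemma mul_homogeneous sigma (w : 'rV[R]_(1 + d)) :
  w *m homogeneous sigma = row_mx (\sum_i w 0 i)%:M (w *m sigma).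
Proof.
rewrite mul_mx_row; congr row_mx; apply/matrixP => i j.
by rewrite !ord1 !mxE; apply: eq_bigr => l _; rewrite mxE mulr1.
Qed.

Lemma homogeneous_unit sigma :
  nondegenerate sigma = (homogeneous sigma \in unitmx).
Proof.
rewrite -row_free_unit; apply/idP/idP => [/nondegenerateP nd|/row_free_inj fr].
  apply: inj_row_free => w; rewrite mul_homogeneous -row_mx0 => /eq_row_mx[w0 ws].
  rewrite row_mx0.
  apply: nd => //; move/matrixP: w0 => /(_ 0 0); by rewrite !mxE eqxx.
apply/nondegenerateP => w w0 ws; apply: fr; rewrite mul0mx mul_homogeneous w0 ws.
by rewrite scalar_mx_is_diag raddf0 row_mx0 || rewrite raddf0 row_mx0.
Qed.

(** Barycentric coordinates when [sigma] is nondegenerate. Being linear in [(1, x)], they are affine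
    in [x]. *)
Definition bary sigma x : 'rV[R]_d.+1 :=
  (row_mx 1%:M x : 'rV[R]_(1 + d)) *m invmx (homogeneous sigma).

Lemma bary_affine sigma e x y :
  bary sigma ((1 - e) *: x + e *: y) = (1 - e) *: bary sigma x + e *: bary sigma y.
Proof.
rewrite /bary !scalemxAl -mulmxDl; congr (_ *m _).
rewrite !scale_row_mx add_row_mx -scalerDl; congr row_mx.
by rewrite subrK scale1r.
Qed.

Lemma bary_affineE sigma e x y i : bary sigma ((1 - e) *: x + e *: y) 0 i =
  (1 - e) * bary sigma x 0 i + e * bary sigma y 0 i.
Proof. by rewrite bary_affine [LHS]mxE; congr (_ + _); rewrite [LHS]mxE. Qed.

Section Nondegenerate.
Variables (sigma : 'M[R]_(d.+1, d)) (nd : nondegenerate sigma).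

Lemma bary_homogeneous x : bary sigma x *m homogeneous sigma = row_mx 1%:M x.
Proof. by rewrite mulmxKV // -homogeneous_unit. Qed.

Lemma bary_sum x : \sum_i bary sigma x 0 i = 1.
Proof.
have := bary_homogeneous x; rewrite mul_homogeneous => /eq_row_mx[+ _].
by move/matrixP => /(_ 0 0); rewrite !mxE eqxx.
Qed.

Lemma baryK x : bary sigma x *m sigma = x.
Proof. by have := bary_homogeneous x; rewrite mul_homogeneous => /eq_row_mx[_]. Qed.

Lemma bary_mul (w : 'rV[R]_d.+1) : \sum_i w 0 i = 1 -> bary sigma (w *m sigma) = w.
Proof.
move=> w1; rewrite /bary.
have -> : row_mx 1%:M (w *m sigma) = w *m homogeneous sigma.
  by rewrite mul_homogeneous w1.
by rewrite mulmxK // -homogeneous_unit.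
Qed.

Lemma simplex_hullE x : simplex_hull sigma x <-> forall i, 0 <= bary sigma x 0 i.
Proof.
split=> [[w [w0 w1 ->]]|b0]; first by rewrite bary_mul.
by exists (bary sigma x); rewrite bary_sum baryK.
Qed.

Lemma simplex_interiorE x :
  simplex_interior sigma x <-> forall i, 0 < bary sigma x 0 i.
Proof.
split=> [[w [w0 w1 ->]]|b0]; first by rewrite bary_mul.
by exists (bary sigma x); rewrite bary_sum baryK.
Qed.

End Nondegenerate.

Definition barycenter sigma : 'rV[R]_d := const_mx (d.+1%:R^-1) *m sigma.

Lemma bary_barycenter sigma : nondegenerate sigma ->
  bary sigma (barycenter sigma) = const_mx (d.+1%:R^-1).
Proof.
move=> nd; rewrite /barycenter bary_mul //.
under eq_bigr do rewrite mxE.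
by rewrite sumr_const card_ord -(mulr_natr _^-1) mulVf ?pnatr_eq0.
Qed.

Lemma barycenter_interior sigma : nondegenerate sigma ->
  simplex_interior sigma (barycenter sigma).
Proof.
by move=> nd; apply/simplex_interiorE => // i; rewrite bary_barycenter // mxE invr_gt0.
Qed.

Lemma simplex_interior_hull k (sigma : 'M[R]_(k.+1, d)) :
  simplex_interior sigma `<=` simplex_hull sigma.
Proof. by move=> x [w [w0 w1 ->]]; exists w; split=> // i; exact: ltW. Qed.

(** The topology enters only through lines: [e] ranges over a neighbourhood of 0, so negative values
    push [x] away from [y]. *)
Lemma bary_cvg sigma x y i :
  bary sigma ((1 - e) *: x + e *: y) 0 i @[e --> (0:R)] --> bary sigma x 0 i.
Proof.
have -> : (fun e : R => bary sigma ((1 - e) *: x + e *: y) 0 i) =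
    (fun e : R => (1 - e) * bary sigma x 0 i + e * bary sigma y 0 i).
  by apply/funext => e; rewrite bary_affineE.
rewrite -[X in _ --> X](_ : (1 - 0) * bary sigma x 0 i + 0 * bary sigma y 0 i = _);
  last by rewrite subr0 mul1r mul0r addr0.
apply: cvgD; apply: cvgMr_tmp; last exact: cvg_id.
by apply: cvgB; [exact: cvg_cst|exact: cvg_id].
Qed.

Lemma near_interior sigma x y : nondegenerate sigma -> simplex_interior sigma x ->
  \forall e \near nbhs (0 : R), simplex_interior sigma ((1 - e) *: x + e *: y).
Proof.
move=> nd /(simplex_interiorE nd) xs.
have : \forall e \near nbhs (0 : R), forall i, 0 < bary sigma ((1 - e) *: x + e *: y) 0 i.
  apply: filter_forall => i.
  exact: (@bary_cvg sigma x y i [set z | 0 < z] (lt_nbhsr (xs i))).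
by apply: filterS => e he; apply/simplex_interiorE.
Qed.

Lemma near_not_hull sigma x y : nondegenerate sigma -> ~ simplex_hull sigma x ->
  \forall e \near nbhs (0 : R), ~ simplex_hull sigma ((1 - e) *: x + e *: y).
Proof.
move=> nd xs.
have /existsNP[i /negP] : ~ forall i, 0 <= bary sigma x 0 i by move=> /(simplex_hullE nd).
rewrite -ltNge => xi.
have : \forall e \near nbhs (0 : R), bary sigma ((1 - e) *: x + e *: y) 0 i < 0.
  exact: (@bary_cvg sigma x y i [set z | z < 0] (lt_nbhsl xi)).
by apply: filterS => e he /(simplex_hullE nd)/(_ i); rewrite leNgt he.
Qed.

Lemma near0_gt0 (P : R -> Prop) : (\forall e \near nbhs (0 : R), P e) ->
  exists e : R, [/\ 0 < e, e < 1, P e & P (- e)].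
Proof.
move=> /nbhs_ballP[r /= r0 rP]; exists (Num.min (r / 2) (1 / 2)).
have m0 : 0 < Num.min (r / 2) (1 / 2) by rewrite lt_min !divr_gt0.
have mr : Num.min (r / 2) (1 / 2) < r.
  by rewrite gt_min; apply/orP; left; rewrite ltr_pdivrMr // ltr_pMr // ltr1n.
split=> //; first by rewrite gt_min; apply/orP; right; lra.
  by apply: rP; rewrite -ball_normE /ball_ /= sub0r normrN gtr0_norm.
by apply: rP; rewrite -ball_normE /ball_ /= sub0r opprK gtr0_norm.
Qed.

(** From an interior point of [tau] one can move slightly away from the barycenter of [sigma] and
    stay in [tau], hence in [sigma]. This lowers every nonpositive coordinate strictly below 0, so
    all coordinates were positive. *)
Lemma simplex_interior_subset sigma tau : nondegenerate sigma -> nondegenerate tau ->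
  simplex_hull tau `<=` simplex_hull sigma ->
  simplex_interior tau `<=` simplex_interior sigma.
Proof.
move=> nds ndt ts x xt; apply/(simplex_interiorE nds) => i.
have [e [e0 _ _ /(@simplex_interior_hull _ _)/ts/(simplex_hullE nds)/(_ i)]] :=
  near0_gt0 (near_interior (barycenter sigma) ndt xt).
rewrite bary_affineE bary_barycenter // [const_mx _ _ _]mxE opprK.
set b := bary _ _ _ _; set c := _^-1 => h.
have c0 : 0 < c by rewrite invr_gt0.
have := mulr_gt0 e0 c0; nra.
Qed.

(** A small move towards the barycenter of [sigma] makes all coordinates for [sigma] positive
    without leaving the interior of [tau]. *)
Lemma simplex_interior_meets sigma tau : nondegenerate sigma -> nondegenerate tau ->
  simplex_interior tau `&` simplex_hull sigma !=set0 ->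
  simplex_interior tau `&` simplex_interior sigma !=set0.
Proof.
move=> nds ndt [x [xt /(simplex_hullE nds) xs]].
have [e [e0 e1 xe _]] := near0_gt0 (near_interior (barycenter sigma) ndt xt).
exists ((1 - e) *: x + e *: barycenter sigma); split=> //.
apply/(simplex_interiorE nds) => i.
rewrite bary_affineE bary_barycenter // [const_mx _ _ _]mxE.
by apply: ltr_wpDl; [rewrite mulr_ge0 // subr_ge0 ltW|rewrite mulr_gt0 ?invr_gt0].
Qed.

(** A point missed by finitely many closed simplexes is missed along a short segment towards the
    barycenter of [sigma], and that segment runs through the interior. *)
Lemma hull_sub_cover sigma (S : seq 'M[R]_(d.+1, d)) : nondegenerate sigma ->
  (forall tau, tau \in S -> nondegenerate tau) ->
  simplex_interior sigma `<=` \bigcup_(tau in [set` S]) simplex_hull tau ->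
  simplex_hull sigma `<=` \bigcup_(tau in [set` S]) simplex_hull tau.
Proof.
move=> nds ndS sub x /(simplex_hullE nds) xs; apply: contrapT => xS.
have : \forall e \near nbhs (0 : R), forall tau, tau \in S ->
    ~ simplex_hull tau ((1 - e) *: x + e *: barycenter sigma).
  have {}xS : forall tau, tau \in S -> ~ simplex_hull tau x.
    by move=> tau tS tx; apply: xS; exists tau.
  elim: S ndS xS {sub} => [|tau S ih] ndS xS; first by apply: nearW => e t; rewrite in_nil.
  have h1 := near_not_hull (barycenter sigma) (ndS tau (mem_head _ _))
    (xS tau (mem_head _ _)).
  have h2 := ih (fun t (tS : t \in S) => ndS t (@mem_behead _ (tau :: S) t tS))
    (fun t (tS : t \in S) => xS t (@mem_behead _ (tau :: S) t tS)).
  apply: filterS2 h1 h2 => e h1 h2 t; rewrite inE => /predU1P[->//|]; exact: h2.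
move=> /near0_gt0[e [e0 e1 h _]].
have : simplex_interior sigma ((1 - e) *: x + e *: barycenter sigma).
  apply/(simplex_interiorE nds) => i; rewrite bary_affineE bary_barycenter // [const_mx _ _ _]mxE.
  by apply: ltr_wpDl; [rewrite mulr_ge0 // subr_ge0 ltW|rewrite mulr_gt0 ?invr_gt0].
by move=> /sub[tau tS]; exact: h.
Qed.

End Barycentric.

(** * Families of nonoverlapping simplexes *)

Section Nonoverlapping.
Context {R : realType} {d k : nat}.
Implicit Types S : seq 'M[R]_(k.+1, d).

Lemma nonoverlapping_cat S1 S2 : nonoverlapping S1 -> nonoverlapping S2 ->
  (forall s t, s \in S1 -> t \in S2 ->
     simplex_interior s `&` simplex_interior t = set0) ->
  nonoverlapping (S1 ++ S2).
Proof.
move=> n1 n2 n12 i j /= iS jS.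
wlog lij : i j iS jS / (i <= j)%N.
  move=> h; case: (leqP i j) => ij; first exact: h.
  by rewrite setIC => ?; apply/esym/h => //; exact: ltnW.
rewrite !nth_cat; move: iS jS; rewrite size_cat.
case: (ltnP i (size S1)) => i1; case: (ltnP j (size S1)) => j1 iS jS.
- exact: n1.
- move=> /set0P/eqP; case; apply: n12; apply: mem_nth => //.
  by rewrite ltn_subLR.
- by have := leq_trans (leq_ltn_trans lij j1) i1; rewrite ltnn.
- move=> h; have := n2 (i - size S1)%N (j - size S1)%N.
  rewrite /= !ltn_subLR // => /(_ iS jS h) /(congr1 (addn^~ (size S1))).
  by rewrite !subnK.
Qed.

Lemma nonoverlapping_eq S s t : nonoverlapping S -> s \in S -> t \in S ->
  simplex_interior s `&` simplex_interior t !=set0 -> s = t.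
Proof.
move=> nS sS tS st; rewrite -(nth_index 0 sS) -(nth_index 0 tS).
by rewrite (nS (index s S) (index t S)) //= ?index_mem // !nth_index.
Qed.

End Nonoverlapping.

(** * Bisection of an edge and trees of bisections *)

Section Bisection.
Context {R : realType} {d : nat}.
Implicit Types (x y : 'rV[R]_d) (sigma tau : 'M[R]_(d.+1, d)).

(* The vertex i moves to a v_i + (1 - a) v_j; the other half of the bisection *)
(* is [bisect sigma j i (1 - a)].                                             *)
Definition bisect sigma (i j : 'I_d.+1) (a : R) : 'M[R]_(d.+1, d) :=
  \matrix_(k, l) (sigma k l + (k == i)%:R * (1 - a) * (sigma j l - sigma i l)).

(** The weights on [sigma] of the point with weights [w] on the half: the share [w 0 i * (1 - a)]
    passes from vertex [i] to vertex [j]. *)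
Definition bisect_weight (i j : 'I_d.+1) (a : R) (w : 'rV[R]_d.+1) :=
  \row_k (w 0 k + w 0 i * (1 - a) * ((k == j)%:R - (k == i)%:R)).

Lemma sum_indicator (i : 'I_d.+1) (f : 'I_d.+1 -> R) :
  \sum_k (k == i)%:R * f k = f i.
Proof.
rewrite (bigD1 i) //= eqxx mul1r big1 ?addr0 // => k /negbTE ->.
by rewrite mul0r.
Qed.

Lemma sum_bisect_weight i j a w : \sum_k bisect_weight i j a w 0 k = \sum_k w 0 k.
Proof.
under eq_bigr do rewrite mxE.
rewrite big_split /= -mulr_sumr sumrB.
have E (l : 'I_d.+1) : \sum_k (k == l)%:R = 1 :> R.
  rewrite -[RHS](sum_indicator l (fun=> 1)); apply: eq_bigr => k _.
  by rewrite mulr1.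
by rewrite !E subrr mulr0 addr0.
Qed.

Lemma mul_bisect sigma i j a w :
  w *m bisect sigma i j a = bisect_weight i j a w *m sigma.
Proof.
apply/rowP => l; rewrite !mxE.
transitivity (\sum_k (w 0 k * sigma k l) +
    w 0 i * (1 - a) * (sigma j l - sigma i l)).
  rewrite -[w 0 i * _ * _](sum_indicator i (fun k => w 0 k * (1 - a) * (sigma j l - sigma i l))).
  by rewrite -big_split; apply: eq_bigr => k _ /=; rewrite mxE; ring.
rewrite -[sigma j l](sum_indicator j (fun k => sigma k l)).
rewrite -[sigma i l](sum_indicator i (fun k => sigma k l)).
rewrite -sumrB mulr_sumr -big_split; apply: eq_bigr => k _ /=.
by rewrite mxE; ring.
Qed.

Lemma row_bisect sigma i j a k : row k (bisect sigma i j a) =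
  if k == i then a *: row i sigma + (1 - a) *: row j sigma else row k sigma.
Proof.
apply/rowP => l; rewrite !mxE; case: eqP => [->|_]; rewrite !mxE ?mul1r ?mul0r ?addr0 //; ring.
Qed.

Section Halves.
Variables (sigma : 'M[R]_(d.+1, d)) (i j : 'I_d.+1) (a : R).
Hypotheses (ij : i != j) (a0 : 0 < a).

Lemma bisect_weight_inj w : bisect_weight i j a w = 0 -> w = 0.
Proof.
move=> w0; have w0k k : w 0 k + w 0 i * (1 - a) * ((k == j)%:R - (k == i)%:R) = 0.
  by move/rowP: w0 => /(_ k); rewrite !mxE.
have wi : w 0 i = 0.
  have := w0k i; rewrite eqxx (negbTE ij) => h.
  have : a * w 0 i = 0 by rewrite -h /= mulr0n mulr1n; ring.
  by move/eqP; rewrite mulf_eq0 (gt_eqF a0) /= => /eqP.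
by apply/rowP => k; have := w0k k; rewrite wi !mul0r addr0 mxE.
Qed.

Lemma bisect_nondegenerate : nondegenerate sigma -> nondegenerate (bisect sigma i j a).
Proof.
move=> /nondegenerateP nd; apply/nondegenerateP => w w0; rewrite mul_bisect => ws.
by apply: bisect_weight_inj; apply: nd => //; rewrite sum_bisect_weight.
Qed.

Hypotheses (a1 : a < 1) (nd : nondegenerate sigma).

(** The cut goes through the new vertex and all vertices other than [i] and [j]; on these, [1 - a]
    times coordinate [i] equals [a] times coordinate [j]. The half keeps [j], which fixes the
    side. *)
Lemma bisect_hullE x : simplex_hull (bisect sigma i j a) x <->
  simplex_hull sigma x /\ (1 - a) * bary sigma x 0 i <= a * bary sigma x 0 j.
Proof.
split.
  case=> w [w0 w1 ->]; rewrite mul_bisect.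
  have ww1 : \sum_k bisect_weight i j a w 0 k = 1 by rewrite sum_bisect_weight.
  split; first (exists (bisect_weight i j a w); split=> //).
    move=> k; rewrite mxE; case: (eqVneq k j) => [->|kj].
      rewrite eq_sym (negbTE ij) subr0 mulr1 addr_ge0 // mulr_ge0 // subr_ge0.
      exact: ltW.
    case: eqP => [->|_]; last by rewrite subrr mulr0 addr0.
    have := mulr_ge0 (ltW a0) (w0 i); rewrite /= mulr0n mulr1n; lra.
  rewrite bary_mul // !mxE !eqxx (negbTE ij) eq_sym (negbTE ij) /= mulr0n mulr1n.
  have := mulr_ge0 (ltW a0) (w0 j); nra.
move=> [/(simplex_hullE nd) b0 bij].
set b := bary sigma x in b0 bij *.
have ba : b 0 i = a * (b 0 i / a) by rewrite mulrCA mulfV ?mulr1 // gt_eqF.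
(* Inverse of [bisect_weight]: the new vertex carries weight [b 0 i / a]. *)
pose w : 'rV[R]_d.+1 := \row_k (b 0 k - (b 0 i / a) * (1 - a) * ((k == j)%:R - (k == i)%:R)).
have wi : w 0 i = b 0 i / a.
  rewrite mxE eqxx (negbTE ij) /= mulr0n mulr1n.
  by move: ba; set c := b 0 i / a => ->; ring.
have bw : bisect_weight i j a w = b.
  by apply/rowP => k; rewrite mxE wi mxE; ring.
exists w; split.
- move=> k; rewrite mxE; case: (eqVneq k j) => [->|kj].
    rewrite eq_sym (negbTE ij) subr0 mulr1 subr_ge0 -(ler_pM2l a0).
    by rewrite mulrA -ba mulrC.
  case: eqP => [->|_]; last by rewrite subrr mulr0 subr0.
  have : 0 <= b 0 i / a by rewrite divr_ge0 // ltW.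
  rewrite [X in _ -> 0 <= X - _]ba /= mulr0n mulr1n.
  by set c := b 0 i / a => c0; have := mulr_ge0 (ltW a0) c0; nra.
- by rewrite -(sum_bisect_weight i j a) bw bary_sum.
- by rewrite mul_bisect bw baryK.
Qed.

End Halves.

Lemma bisect_hull sigma i j a : i != j -> 0 < a -> a < 1 -> nondegenerate sigma ->
  simplex_hull sigma =
  simplex_hull (bisect sigma i j a) `|` simplex_hull (bisect sigma j i (1 - a)).
Proof.
move=> ij a0 a1 nd; have ji : j != i by rewrite eq_sym.
have a0' : 0 < 1 - a by rewrite subr_gt0.
have a1' : 1 - a < 1 by lra.
apply/seteqP; split=> x; last first.
  by case=> /bisect_hullE[].
move=> sx; case: (leP ((1 - a) * bary sigma x 0 i) (a * bary sigma x 0 j)) => h.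
  by left; apply/bisect_hullE.
by right; apply/bisect_hullE => //; split=> //; rewrite subKr ltW.
Qed.

Lemma bisect_disjoint sigma i j a : i != j -> 0 < a -> a < 1 -> nondegenerate sigma ->
  simplex_interior (bisect sigma i j a) `&`
  simplex_interior (bisect sigma j i (1 - a)) = set0.
Proof.
move=> ij a0 a1 nd; have ji : j != i by rewrite eq_sym.
have a0' : 0 < 1 - a by rewrite subr_gt0.
have a1' : 1 - a < 1 by lra.
have main (i' j' : 'I_d.+1) b x : i' != j' -> 0 < b -> b < 1 ->
    simplex_interior (bisect sigma i' j' b) x ->
    (1 - b) * bary sigma x 0 i' < b * bary sigma x 0 j'.
  move=> ij' b0 b1 [w [w0 w1 ->]]; rewrite mul_bisect bary_mul ?sum_bisect_weight //.
  rewrite !mxE !eqxx (negbTE ij') eq_sym (negbTE ij').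
  have := mulr_gt0 b0 (w0 j'); rewrite /= mulr0n mulr1n; nra.
rewrite -subset0 => x [/(main _ _ _ _ ij a0 a1) h1 /(main _ _ _ _ ji a0' a1')].
by rewrite subKr => /(lt_trans h1); rewrite ltxx.
Qed.

(** A derivation is a finite tree of bisections whose leaves satisfy [P]. Several conditions are
    reached one after the other by grafting trees at leaves ([subdivisible_bind]), those already
    reached being kept by [subdivisible_hereditary]. *)
Inductive subdivisible (P : 'M[R]_(d.+1, d) -> Prop) : 'M[R]_(d.+1, d) -> Prop :=
| subdivisible_leaf sigma : P sigma -> subdivisible P sigma
| subdivisible_node sigma i j a : i != j -> 0 < a -> a < 1 ->
    subdivisible P (bisect sigma i j a) ->
    subdivisible P (bisect sigma j i (1 - a)) -> subdivisible P sigma.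

Lemma subdivisible_bind P Q sigma : subdivisible P sigma ->
  (forall tau, P tau -> subdivisible Q tau) -> subdivisible Q sigma.
Proof.
move=> c PQ; elim: c => [tau /PQ//|tau i j a ij a0 a1 _ c1 _ c2].
exact: (subdivisible_node ij a0 a1).
Qed.

Lemma subdivisible_hereditary (A P : 'M[R]_(d.+1, d) -> Prop) sigma :
  (forall tau i j a, i != j -> 0 < a -> a < 1 -> A tau -> A (bisect tau i j a)) ->
  A sigma -> subdivisible P sigma -> subdivisible (fun tau => A tau /\ P tau) sigma.
Proof.
move=> hA + c; elim: c => [tau Pt At|tau i j a ij a0 a1 _ c1 _ c2 At].
  exact: subdivisible_leaf.
apply: (subdivisible_node ij a0 a1); [apply: c1|apply: c2];
  apply: hA => //; rewrite 1?eq_sym //; lra.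
Qed.

(** The leaves of the tree form the refinement; leaves from different halves do not overlap because
    their interiors lie in the disjoint interiors of the halves. *)
Lemma subdivisible_refinement P sigma : nondegenerate sigma -> subdivisible P sigma ->
  exists S : seq 'M[R]_(d.+1, d),
  [/\ forall tau, tau \in S -> nondegenerate tau /\ P tau, nonoverlapping S &
      simplex_hull sigma = \bigcup_(tau in [set` S]) simplex_hull tau].
Proof.
move=> + c; elim: c => [{}sigma Ps nd|{}sigma i j a ij a0 a1 _ ih1 _ ih2 nd].
  exists [:: sigma]; split.
  - by move=> tau; rewrite inE => /eqP ->.
  - by move=> [|?] [|?].
  - apply/seteqP; split=> x; first by exists sigma => //=; rewrite inE.
    by move=> [tau /=]; rewrite inE => /eqP ->.
have ji : j != i by rewrite eq_sym.
have a0' : 0 < 1 - a by rewrite subr_gt0.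
have a1' : 1 - a < 1 by lra.
have nd1 := bisect_nondegenerate ij a0 nd.
have nd2 := bisect_nondegenerate ji a0' nd.
have [S1 [P1 n1 h1]] := ih1 nd1.
have [S2 [P2 n2 h2]] := ih2 nd2.
exists (S1 ++ S2); split.
- by move=> tau; rewrite mem_cat => /orP[/P1|/P2].
- apply: nonoverlapping_cat => // s t sS tS; rewrite -subset0 -(bisect_disjoint ij a0 a1 nd).
  have [nds _] := P1 _ sS; have [ndt _] := P2 _ tS.
  have sub1 : simplex_hull s `<=` simplex_hull (bisect sigma i j a).
    by rewrite h1; exact: (bigcup_sup (i := s)).
  have sub2 : simplex_hull t `<=` simplex_hull (bisect sigma j i (1 - a)).
    by rewrite h2; exact: (bigcup_sup (i := t)).
  have {}sub1 := simplex_interior_subset nd1 nds sub1.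
  have {}sub2 := simplex_interior_subset nd2 ndt sub2.
  by move=> x [/sub1 ? /sub2 ?].
- rewrite (bisect_hull ij a0 a1 nd) h1 h2; apply/seteqP; split=> x.
    by case=> -[tau /= tS tx]; exists tau => //=; rewrite mem_cat tS ?orbT.
  by case=> tau /=; rewrite mem_cat => /orP[] ? ?; [left|right]; exists tau.
Qed.

End Bisection.

(** * Common refinement of finitely many simplexes *)

Section Refinement.
Context {R : realType} {d : nat}.
Implicit Types (x y : 'rV[R]_d) (sigma tau : 'M[R]_(d.+1, d)) (h : 'rV[R]_d -> R).

Definition affine h := forall a x y, h (a *: x + (1 - a) *: y) = a * h x + (1 - a) * h y.

Definition onesided h tau :=
  (forall x, simplex_hull tau x -> 0 <= h x) \/
  (forall x, simplex_hull tau x -> h x <= 0).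

Lemma affine_bary sigma i : affine (fun x => bary sigma x 0 i).
Proof.
move=> a x y; have := bary_affineE sigma (1 - a) x y i.
by rewrite !subKr.
Qed.

Lemma affine_comb h n (v : 'I_n -> 'rV[R]_d) (w : 'I_n -> R) : affine h ->
  (forall i, 0 <= w i) -> \sum_i w i = 1 ->
  h (\sum_i w i *: v i) = \sum_i w i * h (v i).
Proof.
move=> ha; elim: n v w => [|n ih] v w w0 w1.
  by move: w1; rewrite big_ord0 => /eqP; rewrite eq_sym oner_eq0.
rewrite !big_ord_recl; move: w1; rewrite big_ord_recl.
set s := \sum_i w (lift ord0 i) => w1.
have s0 : 0 <= s by apply: sumr_ge0 => i _.
have wE : s = 1 - w ord0 by rewrite -w1 addrAC subrr add0r.
case: (eqVneq s 0) => [s1|s1].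
  have wi i : w (lift ord0 i) = 0.
    by move/eqP: s1; rewrite psumr_eq0 // => /allP/(_ i); rewrite mem_index_enum => /(_ isT)/eqP.
  under eq_bigr do rewrite wi scale0r.
  under [in RHS]eq_bigr do rewrite wi mul0r.
  move: w1; rewrite s1 addr0 => ->; rewrite !sumr_const !mul0rn !addr0.
  by rewrite scale1r mul1r.
have -> : \sum_(i < n) w (lift ord0 i) *: v (lift ord0 i) =
    s *: \sum_(i < n) (s^-1 * w (lift ord0 i)) *: v (lift ord0 i).
  by rewrite scaler_sumr; apply: eq_bigr => i _; rewrite scalerA mulVKf.
rewrite [X in _ + X *: _]wE ha ih; last 2 first.
  by move=> i; rewrite mulr_ge0 // invr_ge0.
  by rewrite -mulr_sumr mulVf.
rewrite -wE mulr_sumr; congr (_ + _); apply: eq_bigr => i _.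
by rewrite mulrA mulVKf.
Qed.

Lemma affine_mul h (w : 'rV[R]_d.+1) sigma : affine h ->
  (forall i, 0 <= w 0 i) -> \sum_i w 0 i = 1 ->
  h (w *m sigma) = \sum_i w 0 i * h (row i sigma).
Proof. by move=> ha w0 w1; rewrite mulmx_sum_row affine_comb. Qed.

Lemma onesided_bisect h tau i j a : i != j -> 0 < a -> a < 1 ->
  nondegenerate tau -> onesided h tau -> onesided h (bisect tau i j a).
Proof.
move=> ij a0 a1 nd [] os; [left|right] => x.
  by move=> /(bisect_hullE ij a0 a1 nd)[/os].
by move=> /(bisect_hullE ij a0 a1 nd)[/os].
Qed.

(** Induction on the number of vertices where [h] does not vanish. If two vertices have opposite
    signs, the edge between them is cut at the zero of [h]; in each half a vertex with nonzero value
    is replaced by one with value 0. *)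
Lemma subdivisible_onesided h sigma : affine h -> subdivisible (onesided h) sigma.
Proof.
move=> ha; have [n] := ubnP #|[set i | h (row i sigma) != 0]%SET|.
elim: n sigma => // n ih sigma; rewrite ltnS => le_n.
case: (boolP [forall i, 0 <= h (row i sigma)]) => [/forallP h0|].
  apply: subdivisible_leaf; left => x [w [w0 w1 ->]].
  by rewrite affine_mul //; apply: sumr_ge0 => i _; rewrite mulr_ge0.
rewrite negb_forall => /existsP[i]; rewrite -ltNge => hi.
case: (boolP [forall i, h (row i sigma) <= 0]) => [/forallP h0|].
  apply: subdivisible_leaf; right => x [w [w0 w1 ->]].
  by rewrite affine_mul //; apply: sumr_le0 => k _; rewrite mulr_ge0_le0.
rewrite negb_forall => /existsP[j]; rewrite -ltNge => hj.
(* The zero of [h] on the edge is [a v_i + (1 - a) v_j]. *)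
pose a := h (row j sigma) / (h (row j sigma) - h (row i sigma)).
have hij : 0 < h (row j sigma) - h (row i sigma) by lra.
have a0 : 0 < a by rewrite divr_gt0.
have a1 : a < 1 by rewrite ltr_pdivrMr // mul1r; lra.
have ij : i != j by apply/eqP => E; move: hi; rewrite E ltNge ltW.
have aE : a * h (row i sigma) + (1 - a) * h (row j sigma) = 0.
  by rewrite /a; field; rewrite gt_eqF.
have main (i' j' : 'I_d.+1) b : h (row i' sigma) != 0 ->
    b * h (row i' sigma) + (1 - b) * h (row j' sigma) = 0 ->
    subdivisible (onesided h) (bisect sigma i' j' b).
  move=> hi' bE; apply: ih; apply: leq_trans le_n; apply: proper_card.
  apply/properP; split.
    apply/fintype.subsetP => k; rewrite !inE row_bisect; case: (eqVneq k i') => [->|//].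
    by rewrite ha bE eqxx.
  by exists i'; rewrite !inE // row_bisect eqxx ha bE eqxx.
apply: (subdivisible_node ij a0 a1); apply: main => //; first by rewrite lt_eqF.
  by rewrite gt_eqF.
by rewrite subKr addrC.
Qed.

Lemma subdivisible_all_onesided (I : eqType) (h : I -> 'rV[R]_d -> R) (s : seq I) sigma :
  (forall i, affine (h i)) -> nondegenerate sigma ->
  subdivisible (fun tau => forall i, i \in s -> onesided (h i) tau) sigma.
Proof.
move=> ha; elim: s sigma => [|i s ih] sigma nd; first exact: subdivisible_leaf.
have c1 := subdivisible_hereditary (fun t k l a kl a0 _ => bisect_nondegenerate kl a0) nd (ih _ nd).
apply: (subdivisible_bind c1) => tau [ndt hs].
have hereditary t k l a : k != l -> 0 < a -> a < 1 ->
    nondegenerate t /\ (forall m, m \in s -> onesided (h m) t) ->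
    nondegenerate (bisect t k l a) /\
    (forall m, m \in s -> onesided (h m) (bisect t k l a)).
  move=> kl a0 a1 [ndt' ht]; split=> [|m ms]; first exact: bisect_nondegenerate.
  exact: onesided_bisect (ht m ms).
apply: (subdivisible_bind (subdivisible_hereditary hereditary (conj ndt hs)
  (subdivisible_onesided tau (ha i)))).
move=> t [[_ ht] hi]; apply: subdivisible_leaf => m; rewrite inE => /predU1P[->//|]; exact: ht.
Qed.

(** All hulls lie in the cube of side [2 * B] centred at 0. The corner simplex with vertex
    [(-B, ..., -B)] and edges of length [l] along the axes contains this cube. *)
Lemma bounding_simplex (L : seq 'M[R]_(d.+1, d)) : exists sigma,
  nondegenerate sigma /\ forall tau, tau \in L -> simplex_hull tau `<=` simplex_hull sigma.
Proof.
pose B := \sum_(t <- L) \sum_i \sum_j `|t i j|.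
have B0 : 0 <= B by do 3!apply: sumr_ge0 => ? _; rewrite normr_ge0.
have BL t i j : t \in L -> `|t i j| <= B.
  move=> tL; rewrite /B (big_rem t) //= -[X in X <= _]addr0 lerD //; last first.
    by do 3!apply: sumr_ge0 => ? _; rewrite normr_ge0.
  rewrite (bigD1 i) //= -[X in X <= _]addr0 lerD //; last first.
    by do 2!apply: sumr_ge0 => ? _; rewrite normr_ge0.
  by rewrite (bigD1 j) //= lerDl sumr_ge0.
(* The coordinates, measured from the corner, add up to at most [2 * d%:R * B]; the extra 1 keeps
   [l] positive. *)
pose l := 2 * d%:R * B + 1.
have l0 : 0 < l by rewrite ltr_wpDl // mulr_ge0 // mulr_ge0.
pose sigma : 'M[R]_(d.+1, d) := \matrix_(i, j) (- B + l * (i == lift ord0 j)%:R).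
have sE (w : 'rV[R]_d.+1) j :
    (w *m sigma) 0 j = - B * (\sum_i w 0 i) + l * w 0 (lift ord0 j).
  rewrite mxE mulr_sumr -[w 0 (lift _ _)](sum_indicator (lift ord0 j) (w 0)).
  by rewrite mulr_sumr -big_split; apply: eq_bigr => i _; rewrite mxE /=; ring.
exists sigma; split.
  apply/nondegenerateP => w w0 ws.
  have wl j : w 0 (lift ord0 j) = 0.
    have := sE w j; rewrite ws w0 mulr0 add0r mxE => /esym/eqP.
    by rewrite mulf_eq0 gt_eqF //= => /eqP.
  apply/rowP => i; rewrite [RHS]mxE; case: (unliftP ord0 i) => [j ->|->] //.
  by move: w0; rewrite big_ord_recl big1 ?addr0.
move=> tau tL x tx.
have xB j : `|x 0 j| <= B.
  case: tx => w [w0 w1 ->]; rewrite mxE; apply: le_trans (ler_norm_sum _ _ _) _.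
  rewrite -[B]mul1r -w1 mulr_suml; apply: ler_sum => i _.
  by rewrite normrM ger0_norm // ler_wpM2l // BL.
have xB1 j : 0 <= x 0 j + B /\ x 0 j + B <= 2 * B.
  by have := xB j; rewrite ler_norml => /andP[]; lra.
pose u j := (x 0 j + B) / l.
have u0 j : 0 <= u j by apply: divr_ge0; [have [] := xB1 j|exact: ltW].
have su : \sum_j u j <= 1.
  rewrite -mulr_suml ler_pdivrMr // mul1r.
  apply: (@le_trans _ _ (\sum_(j < d) (2 * B))).
    by apply: ler_sum => j _; have [] := xB1 j.
  by rewrite sumr_const card_ord -mulr_natr /l; lra.
pose w : 'rV[R]_d.+1 := \row_i if unlift ord0 i is Some j then u j else 1 - \sum_j u j.
have wl j : w 0 (lift ord0 j) = u j by rewrite mxE liftK.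
have ws : \sum_i w 0 i = 1.
  rewrite big_ord_recl [w 0 _]mxE unlift_none.
  transitivity (1 - \sum_j u j + \sum_j u j); last by rewrite subrK.
  by congr (_ + _); apply: eq_bigr => j _; exact: wl.
exists w; split=> //.
  move=> i; rewrite mxE; case: unliftP => [j _|_]; [exact: u0|lra].
apply/rowP => j; rewrite sE ws wl /u; field; rewrite gt_eqF //.
Qed.

(** A bounding simplex is cut until each barycentric coordinate of each [sigma] in [L] has a
    constant sign on each piece. A piece containing an interior point of [sigma] then has all these
    coordinates nonnegative, so it lies in [sigma]. Such pieces cover the interior, hence the
    hull. *)
Lemma common_refinement (L : seq 'M[R]_(d.+1, d)) :
  (forall sigma, sigma \in L -> nondegenerate sigma) ->
  exists S : seq 'M[R]_(d.+1, d),
  [/\ forall tau, tau \in S -> nondegenerate tau, nonoverlapping S &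
      forall sigma, sigma \in L -> simplex_hull sigma =
        \bigcup_(tau in [set tau | tau \in S /\ simplex_hull tau `<=` simplex_hull sigma])
          simplex_hull tau].
Proof.
move=> ndL; have [Delta [ndD LD]] := bounding_simplex L.
pose h (p : 'M[R]_(d.+1, d) * 'I_d.+1) (x : 'rV[R]_d) : R := bary p.1 x 0 p.2.
have ha p : affine (h p) by exact: affine_bary.
have [S [PS nS hS]] := subdivisible_refinement ndD
  (subdivisible_all_onesided [seq (s, i) | s <- L, i <- enum 'I_d.+1] ha ndD).
have ndS tau : tau \in S -> nondegenerate tau by move=> /PS[].
exists S; split=> // sigma sL; have nds := ndL _ sL.
apply/seteqP; split=> x; last by case=> tau [tS ts] /ts.
pose S' := [seq tau <- S | `[< simplex_hull tau `<=` simplex_hull sigma >]].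
have S'P tau : tau \in S' <-> tau \in S /\ simplex_hull tau `<=` simplex_hull sigma.
  rewrite mem_filter; split=> [/andP[/asboolP]|[tS ts]] //.
  by rewrite tS andbT; apply/asboolP.
suff sub : simplex_hull sigma `<=` \bigcup_(tau in [set` S']) simplex_hull tau.
  by move=> /sub[tau /= /S'P tS tx]; exists tau.
apply: hull_sub_cover => //; first by move=> tau /S'P[/ndS].
move=> y ys; have : simplex_hull Delta y by apply: LD sL _ (simplex_interior_hull ys).
rewrite hS => -[tau /= tS ty]; exists tau => //=; apply/S'P; split=> // z tz.
apply/(simplex_hullE nds) => i.
have [_ /(_ (sigma, i))] := PS _ tS; case.
- by apply: allpairs_f => //; rewrite mem_enum.
- exact.
- move=> /(_ _ ty); rewrite leNgt /h /=.
  by have /(simplex_interiorE nds)/(_ i) -> := ys.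
Qed.

End Refinement.

(** * The Euclidean norm and sums of suprema *)

Section EuclideanNorm.
Context {R : realType} {d : nat}.
Implicit Types x : 'rV[R]_d.

Lemma enorm_ge0 x : 0 <= enorm x. Proof. exact: sqrtr_ge0. Qed.

Lemma enormZ a x : enorm (a *: x) = `|a| * enorm x.
Proof.
rewrite /enorm -sqrtr_sqr -sqrtrM ?sqr_ge0 //; congr Num.sqrt.
by rewrite mulr_sumr; apply: eq_bigr => i _; rewrite mxE exprMn.
Qed.

Lemma norm_coord_le_enorm x i : `|x 0 i| <= enorm x.
Proof.
rewrite -sqrtr_sqr; apply: ler_wsqrtr; rewrite (bigD1 i) //= lerDl.
by apply: sumr_ge0 => j _; exact: sqr_ge0.
Qed.

End EuclideanNorm.

Lemma ereal_supD_le {R : realType} (S T : set (\bar R)) (c : \bar R) :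
  (forall x, S x -> 0 <= x)%E -> (forall x, T x -> 0 <= x)%E ->
  S !=set0 -> T !=set0 ->
  (forall x y, S x -> T y -> x + y <= c)%E -> (ereal_sup S + ereal_sup T <= c)%E.
Proof.
move=> S0 T0 [s Ss] [t Tt] ST.
case: (eqVneq c +oo%E) => [->|cy]; first by rewrite leey.
have bounded x : (0 <= x)%E -> (x <= c)%E -> x \is a fin_num.
  move=> x0 xc; rewrite ge0_fin_numE //; apply: le_lt_trans xc _.
  by rewrite ltey.
have Sy x y : S x -> T y -> (x + y <= c)%E by exact: ST.
have Tc y : T y -> (y <= c)%E.
  by move=> Ty; apply: le_trans (ST _ _ Ss Ty); rewrite leeDr // S0.
have supS y : T y -> (ereal_sup S + y <= c)%E.
  move=> Ty; have yfin := bounded _ (T0 _ Ty) (Tc _ Ty).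
  rewrite -leeBrDr //; apply: ge_ereal_sup => x Sx.
  by rewrite leeBrDr //; exact: ST.
have S0' : (0 <= ereal_sup S)%E by apply: le_trans (S0 _ Ss) _; exact: ereal_sup_ubound.
have Sfin : ereal_sup S \is a fin_num.
  apply: bounded => //; apply: le_trans (supS _ Tt); rewrite leeDl //; exact: T0.
rewrite addeC -leeBrDr //; apply: ge_ereal_sup => y Ty.
by rewrite leeBrDr // addeC; exact: supS.
Qed.

(** * Hausdorff measure: separated sets and homotheties *)

Section HausdorffMeasure.
Context {R : realType} {d : nat}.
Implicit Types (x y : 'rV[R]_d) (U A B : set 'rV[R]_d) (k : nat) (delta : R).

Lemma ball_volume_ge0 k : 0 <= ball_volume k :> R.
Proof.
elim/ltn_ind: k => -[|[|k]] ih //.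
by rewrite /= mulr_ge0 ?ih // divr_ge0 // mulr_ge0 // pi_ge0.
Qed.

Lemma diam_ge0 U : U !=set0 -> (0 <= diam U)%E.
Proof.
move=> [x Ux]; apply: ereal_sup_ubound; exists x, x; split=> //.
by rewrite subrr /enorm big1 ?sqrtr0 // => j _; rewrite mxE expr0n.
Qed.

Lemma diam0 : diam (set0 : set 'rV[R]_d) = -oo%E.
Proof. by apply/ereal_sup_ninfty => z [x [y []]]. Qed.

Lemma diamX0 k : diamX k (set0 : set 'rV[R]_d) = 0%E.
Proof. by rewrite /diamX eqxx. Qed.

Lemma diamX_ge0 k U : (0 <= diamX k U)%E.
Proof.
rewrite /diamX; case: ifPn => // /set0P /diam_ge0; exact: expe_ge0.
Qed.

Lemma hausdorff_term_ge0 k U : (0 <= (ball_volume k / 2 ^+ k)%:E * diamX k U)%E.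
Proof.
by rewrite mule_ge0 ?diamX_ge0 // lee_fin divr_ge0 ?ball_volume_ge0 ?exprn_ge0.
Qed.

Lemma hausdorff_delta_ge0 k delta A : (0 <= hausdorff_delta k delta A)%E.
Proof.
apply: le_ereal_inf_tmp => _ [U [_ _ ->]].
by apply: nneseries_ge0 => i _ _; exact: hausdorff_term_ge0.
Qed.

Lemma le_hausdorff_delta k delta A B : A `<=` B ->
  (hausdorff_delta k delta A <= hausdorff_delta k delta B)%E.
Proof.
move=> AB; apply: ereal_inf_le_tmp => z [U [BU dU ->]]; exists U; split=> //.
exact: subset_trans BU.
Qed.

Lemma hausdorff_delta_anti k delta delta' A : delta <= delta' ->
  (hausdorff_delta k delta' A <= hausdorff_delta k delta A)%E.
Proof.
move=> dd; apply: ereal_inf_le_tmp => z [U [AU dU ->]]; exists U; split=> // i.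
by apply: le_trans (dU i) _; rewrite lee_fin.
Qed.

Lemma hausdorff_delta_le k delta A : 0 < delta ->
  (hausdorff_delta k delta A <= hausdorff k A)%E.
Proof. by move=> d0; apply: ereal_sup_ubound; exists delta. Qed.

Lemma le_hausdorff k A B : A `<=` B -> (hausdorff k A <= hausdorff k B)%E.
Proof.
move=> AB; apply: ge_ereal_sup => _ [delta d0 <-].
by apply: le_trans (le_hausdorff_delta _ _ AB) _; exact: hausdorff_delta_le.
Qed.

(** A set of diameter at most [delta < eta] cannot meet both [A] and [B], so a cover of the union
    splits into two covers without sharing a term. *)
Lemma hausdorff_deltaD_separated k delta eta A B : delta < eta ->
  (forall x y, A x -> B y -> eta <= enorm (x - y)) ->
  (hausdorff_delta k delta A + hausdorff_delta k delta B <=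
   hausdorff_delta k delta (A `|` B))%E.
Proof.
move=> de sep; apply: le_ereal_inf_tmp => _ [U [ABU dU ->]].
(* Discarded sets become empty: their diameter [-oo] respects the scale, and their term is 0. *)
pose part C i := if asbool (U i `&` C !=set0) then U i else set0.
have dpart C i : (diam (part C i) <= delta%:E)%E.
  by rewrite /part; case: ifP => // _; rewrite diam0 leNye.
have coverC C : C `<=` A `|` B -> C `<=` \bigcup_i part C i.
  move=> CAB x Cx; have [i _ Ux] := ABU x (CAB x Cx); exists i => //.
  by rewrite /part asboolT //; exists x.
apply: (@le_trans _ _ (\sum_(0 <= i <oo) ((ball_volume k / 2 ^+ k)%:E * diamX k (part A i)) +
    \sum_(0 <= i <oo) ((ball_volume k / 2 ^+ k)%:E * diamX k (part B i)))%E).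
  apply: leeD; apply: ereal_inf_lbound; [exists (part A)|exists (part B)]; split=> //.
    by apply: coverC; exact: subsetUl.
  by apply: coverC; exact: subsetUr.
rewrite -nneseriesD; last 2 first.
  by move=> i _ _; exact: hausdorff_term_ge0.
  by move=> i _ _; exact: hausdorff_term_ge0.
apply: lee_nneseries => [i _ _|i _].
  by apply: adde_ge0; exact: hausdorff_term_ge0.
rewrite -ge0_muleDr ?diamX_ge0 //; apply: lee_wpmul2l.
  by rewrite lee_fin divr_ge0 ?ball_volume_ge0 ?exprn_ge0.
rewrite /part; case: asboolP => [[x [Ux Ax]]|_]; case: asboolP => [[y [Uy By]]|_];
  rewrite ?diamX0 ?adde0 ?add0e ?diamX_ge0 //.
have : (diam (U i) < eta%:E)%E by apply: le_lt_trans (dU i) _; rewrite lte_fin.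
rewrite ltNge; case/negP.
apply: le_trans (_ : _ <= (enorm (x - y))%:E)%E _; first by rewrite lee_fin sep.
by apply: ereal_sup_ubound; exists x, y.
Qed.

Lemma hausdorffD_separated k eta A B : 0 < eta ->
  (forall x y, A x -> B y -> eta <= enorm (x - y)) ->
  (hausdorff k A + hausdorff k B <= hausdorff k (A `|` B))%E.
Proof.
move=> eta0 sep; apply: ereal_supD_le.
- by move=> _ [delta _ <-]; exact: hausdorff_delta_ge0.
- by move=> _ [delta _ <-]; exact: hausdorff_delta_ge0.
- by exists (hausdorff_delta k 1 A), 1 => //=.
- by exists (hausdorff_delta k 1 B), 1 => //=.
move=> _ _ [d1 /= d10 <-] [d2 /= d20 <-].
(* [hausdorff_delta] increases as the scale decreases, so both scales may be lowered to a common one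
   below [eta]. *)
pose delta := Num.min (Num.min d1 d2) (eta / 2).
have delta0 : 0 < delta by rewrite !lt_min d10 d20 divr_gt0.
have delta1 : delta <= d1 by rewrite !ge_min lexx.
have delta2 : delta <= d2 by rewrite !ge_min lexx orbT.
have delta3 : delta < eta.
  by rewrite gt_min; apply/orP; right; rewrite ltr_pdivrMr // ltr_pMr // ltr1n.
apply: le_trans (hausdorff_delta_le k (A `|` B) delta0).
apply: le_trans (hausdorff_deltaD_separated k delta3 sep).
by apply: leeD; exact: hausdorff_delta_anti.
Qed.

(** A cover of the image at scale [s * delta] pulls back to a cover of [A] at scale [delta], with
    diameters divided by at least [s]. *)
Lemma hausdorff_homothety k (s : R) (c : 'rV[R]_d) A : 0 < s ->
  ((s ^+ k)%:E * hausdorff k A <= hausdorff k [set (s *: x + c)%R | x in A])%E.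
Proof.
move=> s0; pose f x := s *: x + c.
have fE x y : enorm (f x - f y) = s * enorm (x - y).
  by rewrite /f opprD addrACA subrr addr0 -scalerBr enormZ gtr0_norm.
rewrite -ereal_sup_pZl ?exprn_gt0 //; apply: ge_ereal_sup.
move=> _ [_ [delta /= delta0 <-] <-].
have sd0 : 0 < s * delta by rewrite mulr_gt0.
apply: le_trans (hausdorff_delta_le k _ sd0).
apply: le_ereal_inf_tmp => _ [U [fAU dU ->]].
have dpre i : (diam (f @^-1` U i) <= delta%:E)%E.
  apply: ge_ereal_sup => _ [x [y [Ux Uy ->]]].
  rewrite lee_fin -(ler_pM2l s0) -fE -lee_fin; apply: le_trans (dU i).
  by apply: ereal_sup_ubound; exists (f x), (f y).
apply: (@le_trans _ _ ((s ^+ k)%:E * \sum_(0 <= i <oo)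
    ((ball_volume k / 2 ^+ k)%:E * diamX k (f @^-1` U i)))%E).
  apply: lee_wpmul2l; first by rewrite lee_fin exprn_ge0 // ltW.
  apply: ereal_inf_lbound; exists (fun i => f @^-1` U i); split=> // x Ax.
  by have [i _ Ui] := fAU (f x) (ex_intro2 _ _ x Ax erefl); exists i.
rewrite -nneseriesZl; last by move=> i _; exact: hausdorff_term_ge0.
apply: lee_nneseries => [i _ _|i _].
  by rewrite mule_ge0 ?hausdorff_term_ge0 // lee_fin exprn_ge0 // ltW.
rewrite muleCA; apply: lee_wpmul2l.
  by rewrite lee_fin divr_ge0 ?ball_volume_ge0 ?exprn_ge0.
rewrite /diamX; case: ifPn => [_|/set0P [x Ux]].
  by rewrite mule0; exact: diamX_ge0.
case: ifPn => [/eqP U0|_]; first by move: Ux; rewrite /preimage /= U0.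
have d1 : diam (f @^-1` U i) \is a fin_num.
  rewrite ge0_fin_numE; last by apply: diam_ge0; exists x.
  exact: le_lt_trans (dpre i) (ltry _).
have d2 : diam (U i) \is a fin_num.
  rewrite ge0_fin_numE; last by apply: diam_ge0; exists (f x).
  exact: le_lt_trans (dU i) (ltry _).
have d12 : s * fine (diam (f @^-1` U i)) <= fine (diam (U i)).
  rewrite -lee_fin EFinM !fineK // -lee_pdivlMl //; apply: ge_ereal_sup.
  move=> _ [y [z [Uy Uz ->]]]; rewrite lee_pdivlMl // -EFinM -fE.
  by apply: ereal_sup_ubound; exists (f y), (f z).
rewrite -(fineK d1) -(fineK d2) -!EFin_expe -EFinM lee_fin -exprMn.
apply: lerXn2r => //; rewrite nnegrE.
  by rewrite mulr_ge0 ?(ltW s0) // fine_ge0 // diam_ge0 //; exists x.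
by rewrite fine_ge0 // diam_ge0 //; exists (f x).
Qed.

End HausdorffMeasure.

(** * Superadditivity of Hausdorff measure on nonoverlapping simplexes *)

Section Superadditivity.
Context {R : realType} {d : nat}.
Implicit Types (x y : 'rV[R]_d) (sigma tau : 'M[R]_(d.+1, d)) (B : set 'rV[R]_d).

Definition shrink (r : R) sigma : set 'rV[R]_d :=
  [set ((1 - r) *: x + r *: barycenter sigma) | x in simplex_hull sigma].

Lemma bary_shrink r sigma x i : nondegenerate sigma -> 0 < r -> r < 1 ->
  shrink r sigma x -> r / d.+1%:R <= bary sigma x 0 i.
Proof.
move=> nd r0 r1 [y /(simplex_hullE nd) y0 <-].
rewrite bary_affineE bary_barycenter // [const_mx _ _ _]mxE lerDr.
by rewrite mulr_ge0 // subr_ge0 ltW.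
Qed.

Lemma shrink_interior r sigma : nondegenerate sigma -> 0 < r -> r < 1 ->
  shrink r sigma `<=` simplex_interior sigma.
Proof.
move=> nd r0 r1 x xs; apply/(simplex_interiorE nd) => i.
by apply: lt_le_trans (bary_shrink i nd r0 r1 xs); rewrite divr_gt0.
Qed.

Lemma bary_lipschitz sigma : exists2 L : R, 0 < L &
  forall x y i, bary sigma x 0 i - bary sigma y 0 i <= L * enorm (x - y).
Proof.
pose M := invmx (homogeneous sigma).
pose L := \sum_i \sum_k `|M k i|.
have L0 : 0 <= L by do 2!apply: sumr_ge0 => ? _.
exists (L + 1); first by rewrite ltr_wpDl.
move=> x y i.
have -> : bary sigma x 0 i - bary sigma y 0 i =
    ((row_mx 0 (x - y) : 'rV[R]_(1 + d)) *m M) 0 i.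
  have -> : (row_mx 0 (x - y) : 'rV[R]_(1 + d)) = row_mx 1%:M x - row_mx 1%:M y.
    by rewrite opp_row_mx add_row_mx subrr.
  by rewrite mulmxBl [RHS]mxE [X in _ = _ + X]mxE.
apply: le_trans (ler_norm _) _; rewrite mxE.
apply: le_trans (ler_norm_sum _ _ _) _.
apply: (@le_trans _ _ (\sum_k enorm (x - y) * `|M k i|)).
  apply: ler_sum => k _; rewrite normrM ler_wpM2r //.
  rewrite -(splitK k); case: (fintype.split k) => l /=.
    by rewrite row_mxEl mxE normr0 enorm_ge0.
  by rewrite row_mxEr norm_coord_le_enorm.
rewrite -mulr_sumr mulrC ler_wpM2r ?enorm_ge0 //.
apply: ler_wpDr => //; rewrite /L [X in _ <= X](bigD1 i) //= lerDl.
by do 2!apply: sumr_ge0 => ? _.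
Qed.

(** Each coordinate is at least [r / d.+1%:R] on the shrunk simplex, while some coordinate is
    nonpositive off the interior. The Lipschitz bound on coordinates turns this gap into a
    distance. *)
Lemma shrink_separated r sigma : nondegenerate sigma -> 0 < r -> r < 1 ->
  exists2 eta : R, 0 < eta &
  forall x y, shrink r sigma x -> ~ simplex_interior sigma y -> eta <= enorm (x - y).
Proof.
move=> nd r0 r1; have [L L0 HL] := bary_lipschitz sigma.
exists (r / d.+1%:R / L); first by rewrite !divr_gt0.
move=> x y xs ys.
have /existsNP[i /negP] : ~ forall i, 0 < bary sigma y 0 i by move=> /(simplex_interiorE nd).
rewrite -leNgt => yi; rewrite ler_pdivrMr // [_ * L]mulrC.
apply: le_trans (HL x y i); apply: le_trans (bary_shrink i nd r0 r1 xs) _.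
by rewrite lerBrDr -lerBrDl subrr.
Qed.

Lemma bernoulli_expr (r : R) n : 0 <= r -> r <= 1 -> 1 - n%:R * r <= (1 - r) ^+ n.
Proof.
move=> r0 r1; elim: n => [|n ih]; first by rewrite mul0r subr0 expr0.
have n0 : 0 <= n%:R :> R by [].
rewrite exprS; apply: le_trans (ler_wpM2l _ ih); last by rewrite subr_ge0.
rewrite -natr1; have := mulr_ge0 (mulr_ge0 n0 r0) r0; lra.
Qed.

Lemma nonoverlapping_cons sigma (S : seq 'M[R]_(d.+1, d)) :
  nonoverlapping (sigma :: S) -> nonoverlapping S /\
  forall tau, tau \in S -> simplex_interior sigma `&` simplex_interior tau = set0.
Proof.
move=> n; split.
  by move=> i j iS jS h; have /succn_inj := n i.+1 j.+1 iS jS h.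
move=> tau tS; apply: contrapT => /eqP/set0P h.
have := n 0%N (index tau S).+1 isT; rewrite /= ltnS index_mem nth_index //.
by move=> /(_ tS h).
Qed.

Lemma shrink_hausdorff_sum (S : seq 'M[R]_(d.+1, d)) r : 0 < r -> r < 1 ->
  (forall tau, tau \in S -> nondegenerate tau) -> nonoverlapping S ->
  (\sum_(tau <- S) hausdorff d (shrink r tau) <=
   hausdorff d (\bigcup_(tau in [set` S]) shrink r tau))%E.
Proof.
move=> r0 r1; elim: S => [|sigma S ih] nd non; first by rewrite big_nil hausdorff_ge0.
have [nonS disj] := nonoverlapping_cons non.
have nds := nd _ (mem_head _ _).
have ndS tau : tau \in S -> nondegenerate tau by move=> tS; apply: nd; rewrite inE tS orbT.
have [eta eta0 sep] := shrink_separated nds r0 r1.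
rewrite big_cons; apply: le_trans (leeD2l _ (ih ndS nonS)) _.
apply: le_trans (hausdorffD_separated d eta0 _) _; last first.
  apply: le_hausdorff => x [xs|[tau /= tS xt]].
    by exists sigma => //=; rewrite mem_head.
  by exists tau => //=; rewrite inE tS orbT.
move=> x y xs [tau /= tS yt]; apply: sep => // ys.
rewrite -[False]/(set0 y) -(disj _ tS); split=> //.
exact: (shrink_interior (ndS _ tS) r0 r1).
Qed.

(** Shrunk simplexes are pairwise separated, so their measures add up to at most that of [B].
    Shrinking costs a factor [(1 - r) ^+ d], which tends to 1 with [r] tending to 0. *)
Lemma hausdorff_simplexes_le (S : seq 'M[R]_(d.+1, d)) B :
  (forall tau, tau \in S -> nondegenerate tau) -> nonoverlapping S ->
  (forall tau, tau \in S -> simplex_hull tau `<=` B) ->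
  (\sum_(tau <- S) hausdorff d (simplex_hull tau) <= hausdorff d B)%E.
Proof.
move=> nd non SB.
have main r : 0 < r -> r < 1 -> (((1 - r) ^+ d)%:E *
    \sum_(tau <- S) hausdorff d (simplex_hull tau) <= hausdorff d B)%E.
  move=> r0 r1; rewrite ge0_sume_distrr; last by move=> *; exact: hausdorff_ge0.
  apply: (@le_trans _ _ (\sum_(tau <- S) hausdorff d (shrink r tau))%E).
    by apply: lee_sum => tau _; apply: hausdorff_homothety; rewrite subr_gt0.
  apply: le_trans (shrink_hausdorff_sum r0 r1 nd non) _.
  apply: le_hausdorff => x [tau /= tS xt]; apply: (SB tau tS).
  exact: simplex_interior_hull (shrink_interior (nd _ tS) r0 r1 xt).
have : (0 <= \sum_(tau <- S) hausdorff d (simplex_hull tau))%E.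
  by apply: sume_ge0 => *; exact: hausdorff_ge0.
have := hausdorff_ge0 d B.
move: (hausdorff d B) (\sum_(tau <- S) _)%E main => [b||] [a||] main //=.
- rewrite !lee_fin => b0 a0; apply/ler_addgt0Pr => e e0.
  (* By Bernoulli the loss is at most [d%:R * r * a], which this [r] keeps below [e]. *)
  pose r := Num.min (1 / 2) (e / (d%:R * a + 1)).
  have da0 : 0 <= d%:R * a by rewrite mulr_ge0.
  have r0 : 0 < r by rewrite lt_min !divr_gt0 // ltr_wpDl.
  have r1 : r < 1 by rewrite gt_min; apply/orP; left; lra.
  have re : r * (d%:R * a + 1) <= e.
    by rewrite -ler_pdivlMr ?ltr_wpDl // ge_min lexx orbT.
  have := main _ r0 r1; rewrite -EFinM lee_fin => h.
  have := ler_wpM2r a0 (bernoulli_expr d (ltW r0) (ltW r1)).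
  move: h re; set p := _ ^+ _; nra.
(* An infinite sum is excluded when [B] has finite measure: [r = 1 / 2] already gives a
   contradiction. *)
- have h2 : 1 / 2 < 1 :> R by lra.
  have h1 : 0 < 1 / 2 :> R by lra.
  have := main _ h1 h2; rewrite mulry gtr0_sg ?mul1e // exprn_gt0 //; lra.
- by move=> _ _; exact: leey.
Qed.

End Superadditivity.

(** * Subdivisions, densities and equality of chains *)

Section Subdivision.
Context {R : realType} {d : nat}.
Implicit Types (sigma tau : 'M[R]_(d.+1, d)) (S : seq 'M[R]_(d.+1, d)).

Lemma nonoverlapping_filter (p : pred 'M[R]_(d.+1, d)) S :
  nonoverlapping S -> nonoverlapping [seq tau <- S | p tau].
Proof.
elim: S => // s S ih /nonoverlapping_cons[nS disj] /=; case: ifP => _; last exact: ih.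
rewrite -cat1s; apply: nonoverlapping_cat; [by move=> [|?] [|?]|exact: ih|].
move=> t t'; rewrite inE => /eqP ->; rewrite mem_filter => /andP[_]; exact: disj.
Qed.

Lemma nonoverlapping_uniq S : (forall tau, tau \in S -> nondegenerate tau) ->
  nonoverlapping S -> uniq S.
Proof.
elim: S => // s S ih nd /nonoverlapping_cons[nS disj] /=; apply/andP; split.
  apply/negP => /disj; rewrite setIid -subset0 => h.
  exact: h _ (barycenter_interior (nd _ (mem_head _ _))).
by apply: ih => // tau tS; apply: nd; rewrite inE tS orbT.
Qed.

Context {G : zmodType}.
Implicit Types (P Q : formal_sum (R := R) d G d).

Definition proper_sum P := forall t, t \in P -> nondegenerate t.2.

Lemma proper_cat P Q : proper_sum P -> proper_sum Q -> proper_sum (P ++ Q).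
Proof. by move=> nP nQ t; rewrite mem_cat => /orP[/nP|/nQ]. Qed.

Lemma proper_fsub P Q : proper_sum P -> proper_sum Q -> proper_sum (fsub P Q).
Proof.
by move=> nP nQ; apply: proper_cat => // _ /mapP[t tQ ->]; exact: (nQ t tQ).
Qed.

Lemma coef_cat P Q tau : coef (P ++ Q) tau = coef P tau + coef Q tau.
Proof. by rewrite /coef big_cat. Qed.

Lemma coef_opp P tau : coef [seq (- t.1, t.2) | t <- P] tau = - coef P tau.
Proof.
rewrite /coef big_map -sumrN; apply: eq_bigr => t _ /=.
by case: ifP => // _; rewrite opprK.
Qed.

Lemma coef_fsub P Q tau : coef (fsub P Q) tau = coef P tau - coef Q tau.
Proof. by rewrite coef_cat coef_opp. Qed.

(** One interior point decides whether a piece lies in [t]: if [x] is in [t], some piece of [t]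
    contains [x], and it overlaps [tau], so it is [tau]. *)
Lemma subdivides_sub S P tau t x : subdivides S P -> proper_sum P ->
  tau \in S -> t \in P -> simplex_interior tau x ->
  simplex_hull tau `<=` simplex_hull t.2 <-> simplex_interior t.2 x.
Proof.
move=> [ndS nS SP] nP tS tP tx; split=> [sub|xt].
  exact: (simplex_interior_subset (nP t tP) (ndS _ tS) sub).
have : simplex_hull t.2 x by exact: simplex_interior_hull.
rewrite {1}(SP t tP) => -[tau' [tS' sub] x'].
have : simplex_interior tau `&` simplex_interior tau' !=set0.
  by apply: simplex_interior_meets; [exact: ndS|exact: ndS|exists x].
by move=> /(nonoverlapping_eq nS tS tS') ->.
Qed.

(** The multiplicity of [P] at [x] with respect to the standard orientation of the space; it refers
    to no subdivision. *)
Definition density P x : G := \sum_(t <- P | `[< simplex_interior t.2 x >])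
  (if 0 < \det (simplex_edges t.2) then t.1 else - t.1).

Lemma det_edges_neq0 sigma : nondegenerate sigma -> \det (simplex_edges sigma) != 0.
Proof. by rewrite /nondegenerate row_free_unit unitmxE unitfE. Qed.

(** In top dimension the edge matrices are square, so the determinant comparing two orientations is
    the product of their determinants. *)
Lemma coef_density S P tau x : subdivides S P -> proper_sum P ->
  tau \in S -> simplex_interior tau x ->
  coef P tau = if 0 < \det (simplex_edges tau) then density P x else - density P x.
Proof.
move=> SP nP tS tx; have [ndS _ _] := SP.
have E : coef P tau = \sum_(t <- P | `[< simplex_interior t.2 x >])
    (if same_orientation tau t.2 then t.1 else - t.1).
  rewrite /coef big_seq_cond [RHS]big_seq_cond; apply: eq_bigl => t.
  case: (boolP (t \in P)) => //= tP; apply/asboolP/asboolP;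
    by move=> /(subdivides_sub SP nP tS tP tx).
rewrite E /density; have := det_edges_neq0 (ndS _ tS).
case: ltgtP => // taus _.
  rewrite big_seq_cond [RHS]big_seq_cond; apply: eq_bigr => t /andP[tP _].
  by rewrite /same_orientation det_mulmx det_tr pmulr_rgt0.
rewrite -sumrN big_seq_cond [RHS]big_seq_cond; apply: eq_bigr => t /andP[tP _].
rewrite /same_orientation det_mulmx det_tr nmulr_rgt0 //.
by have := det_edges_neq0 (nP t tP); case: ltgtP => // _ _; rewrite opprK.
Qed.

Lemma density_eq S P Q tau x : subdivides S P -> subdivides S Q ->
  proper_sum P -> proper_sum Q -> tau \in S -> simplex_interior tau x ->
  coef P tau = coef Q tau <-> density P x = density Q x.
Proof.
move=> SP SQ nP nQ tS tx.
rewrite (coef_density SP nP tS tx) (coef_density SQ nQ tS tx).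
by case: ifP => _; split=> [|->] // /oppr_inj.
Qed.

Lemma density_out P x : (forall t, t \in P -> ~ simplex_hull t.2 x) -> density P x = 0.
Proof.
move=> h; rewrite /density big_seq_cond big1 // => t /andP[tP /asboolP].
by move=> /simplex_interior_hull /(h t tP).
Qed.

(* Two subdivisions give the same comparison of coefficients, because both    *)
(* can be read off the densities at a common interior point.                  *)
Lemma same_chain_coef S P Q : same_chain P Q -> proper_sum P -> proper_sum Q ->
  subdivides S P -> subdivides S Q -> forall tau, tau \in S -> coef P tau = coef Q tau.
Proof.
move=> [S1 [SP1 SQ1 PQ1]] nP nQ SP SQ tau tS.
have [ndS _ _] := SP; have [ndS1 _ cP] := SP1; have [_ _ cQ] := SQ1.
have [[x [t [tx tPQ xt]]]|none] := pselect (exists x t,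
    [/\ simplex_interior tau x, t \in P ++ Q & simplex_hull t.2 x]).
  have [tau1 tS1 x1] : exists2 tau1, tau1 \in S1 & simplex_hull tau1 x.
    move: tPQ xt; rewrite mem_cat => /orP[tP|tQ].
      by rewrite (cP _ tP) => -[tau1 [? _] ?]; exists tau1.
    by rewrite (cQ _ tQ) => -[tau1 [? _] ?]; exists tau1.
  have [y [ty y1]] : simplex_interior tau `&` simplex_interior tau1 !=set0.
    by apply: simplex_interior_meets; [exact: ndS1|exact: ndS|exists x].
  apply/(density_eq SP SQ nP nQ tS ty).
  by apply/(density_eq SP1 SQ1 nP nQ tS1 y1); exact: PQ1.
have tb := barycenter_interior (ndS _ tS).
apply/(density_eq SP SQ nP nQ tS tb); rewrite !density_out // => t tPQ xt;
  by apply: none; exists (barycenter tau), t; rewrite mem_cat tPQ ?orbT.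
Qed.

Lemma subdivides_exists (L : seq 'M[R]_(d.+1, d)) :
  (forall sigma, sigma \in L -> nondegenerate sigma) ->
  exists S, forall P, (forall t, t \in P -> t.2 \in L) -> subdivides S P.
Proof.
move=> ndL; have [S [ndS nS cS]] := common_refinement ndL.
by exists S => P PL; split=> // t tP; apply: cS; exact: PL.
Qed.

Lemma subdivides_all (Ps : seq (formal_sum (R := R) d G d)) :
  (forall P, P \in Ps -> proper_sum P) ->
  exists S, forall P, P \in Ps -> subdivides S P.
Proof.
move=> nPs; have [|S hS] := @subdivides_exists [seq t.2 | t <- flatten Ps].
  by move=> _ /mapP[t /flattenP[P PPs tP] ->]; exact: (nPs P PPs).
exists S => P PPs; apply: hS => t tP; apply: map_f; apply/flattenP.
by exists P.
Qed.

(** The two given equalities may live on different subdivisions; [same_chain_coef] moves both to one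
    that subdivides all three sums. *)
Lemma same_chain_trans P Q T : proper_sum P -> proper_sum Q -> proper_sum T ->
  same_chain P Q -> same_chain Q T -> same_chain P T.
Proof.
move=> nP nQ nT PQ QT; have [|S hS] := @subdivides_all [:: P; Q; T].
  by move=> U; rewrite !inE => /or3P[] /eqP ->.
have SP : subdivides S P by apply: hS; rewrite inE eqxx.
have SQ : subdivides S Q by apply: hS; rewrite !inE eqxx orbT.
have ST : subdivides S T by apply: hS; rewrite !inE eqxx !orbT.
exists S; split=> // tau tS.
by rewrite (same_chain_coef PQ nP nQ SP SQ tS) (same_chain_coef QT nQ nT SQ ST tS).
Qed.

End Subdivision.

(** * Polyhedral chains and the flat distance in top dimension *)

Section TopDimension.
Context {R : realType} {d : nat} {K : set 'rV[R]_d} {G : normedGroup R}.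
Implicit Types (P Q S T : polychain K G d).

Lemma ng_norm0 : ng_norm (0 : G) = 0.
Proof. exact/ng_norm_eq0. Qed.

Lemma ng_norm_sum (I : Type) (r : seq I) (p : pred I) (F : I -> G) :
  ng_norm (\sum_(i <- r | p i) F i) <= \sum_(i <- r | p i) ng_norm (F i).
Proof.
elim/big_ind2 : _ => [|x1 x2 y1 y2 h1 h2|//]; first by rewrite ng_norm0.
by apply: le_trans (ng_normD _ _) _; exact: lerD.
Qed.

Lemma poly_proper P : proper_sum P.
Proof. by move=> t /poly_simplex[]. Qed.
Arguments poly_proper : clear implicits.

Definition formal_mass (P : formal_sum (R := R) d G d) : \bar R :=
  (\sum_(t <- P) (ng_norm t.1)%:E * hausdorff d (simplex_hull t.2))%E.

(** Removes overlaps without increasing mass: coefficients on a piece are added, which the triangle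
    inequality controls, and the pieces of one simplex have total measure at most its own. *)
Lemma polychain_exists (P : formal_sum (R := R) d G d) :
  (forall t, t \in P -> nondegenerate t.2 /\ simplex_hull t.2 `<=` K) ->
  exists T : polychain K G d, same_chain T P /\ (poly_mass T <= formal_mass P)%E.
Proof.
move=> PK; have nP : proper_sum P by move=> t /PK[].
have [|S hS] := @subdivides_all R d G [:: P]; first by move=> U; rewrite inE => /eqP ->.
have [ndS nS cS] := hS P (mem_head _ _).
(* Pieces outside every simplex of [P] are dropped, since they may leave [K]. *)
pose used (tau : 'M[R]_(d.+1, d)) :=
  has (fun t => `[< simplex_hull tau `<=` simplex_hull t.2 >]) P.
pose S' := [seq tau <- S | used tau].
have S'S tau : tau \in S' -> tau \in S by rewrite mem_filter => /andP[].
have ndS' tau : tau \in S' -> nondegenerate tau by move=> /S'S /ndS.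
have nS' : nonoverlapping S' by exact: nonoverlapping_filter.
have uS' := nonoverlapping_uniq ndS' nS'.
pose T : formal_sum (R := R) d G d := [seq (coef P tau, tau) | tau <- S'].
have TK t : t \in T -> nondegenerate t.2 /\ simplex_hull t.2 `<=` K.
  move=> /mapP[tau tS' ->] /=; split; first exact: ndS'.
  move: tS'; rewrite mem_filter => /andP[/hasP[s sP /asboolP ts] _].
  by apply: subset_trans ts _; have [] := PK _ sP.
have T2 : [seq t.2 | t <- T] = S' by rewrite -map_comp map_id.
have nT : nonoverlapping [seq t.2 | t <- T] by rewrite T2.
exists (Polychain TK nT); split.
  exists S'; split.
  - split=> // _ /mapP[tau tS' ->] /=; apply/seteqP; split=> x.
      by move=> tx; exists tau => //; split.
    by move=> [tau' [_ sub] /sub].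
  - split=> // t tP; apply/seteqP; split=> x; last by move=> [tau' [_ sub] /sub].
    rewrite {1}(cS t tP) => -[tau' [tS sub] tx]; exists tau' => //; split=> //.
    by rewrite mem_filter tS andbT; apply/hasP; exists t => //; exact/asboolP.
  (* Only [tau] itself contributes to the coefficient of [T], another piece containing it would
     overlap it; its sign is positive because the determinant is a square. *)
  move=> tau tS' /=; rewrite /coef big_map big_mkcond /= (bigD1_seq tau) //=.
  rewrite asboolT // big_seq_cond big1 ?addr0; last first.
    move=> tau' /andP[tS1 ne]; case: asboolP => // sub; exfalso.
    move/eqP: ne; apply; apply: (nonoverlapping_eq nS') => //.
    have tb := barycenter_interior (ndS' _ tS').
    exists (barycenter tau); split=> //.
    exact: (simplex_interior_subset (ndS' _ tS1) (ndS' _ tS') sub).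
  rewrite /same_orientation det_mulmx det_tr -expr2 lt0r sqr_ge0 andbT.
  by rewrite sqrf_eq0 det_edges_neq0 // ndS'.
rewrite /poly_mass /= big_map /=.
apply: (@le_trans _ _ (\sum_(tau <- S') \sum_(t <- P | `[< simplex_hull tau `<=` simplex_hull t.2 >])
    (ng_norm t.1)%:E * hausdorff d (simplex_hull tau))%E).
  apply: lee_sum => tau _; rewrite -ge0_sume_distrl; last first.
    by move=> t _; rewrite lee_fin ng_norm_ge0.
  apply: lee_wpmul2r; first exact: hausdorff_ge0.
  rewrite sumEFin lee_fin; apply: le_trans (ng_norm_sum _ _ _) _.
  by apply: ler_sum => t _; case: ifP => // _; rewrite ng_normN.
rewrite (exchange_big_dep xpredT) //=; apply: lee_sum => t _.
rewrite -ge0_sume_distrr; last by move=> tau _; exact: hausdorff_ge0.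
apply: lee_wpmul2l; first by rewrite lee_fin ng_norm_ge0.
rewrite -big_filter; apply: hausdorff_simplexes_le.
- by move=> tau; rewrite mem_filter => /andP[_ /ndS'].
- exact: nonoverlapping_filter.
- by move=> tau; rewrite mem_filter => /andP[/asboolP].
Qed.

(** The [d.+1] edges of such a simplex cannot be independent in dimension [d]. The infimum in the
    flat norm therefore only involves [Q = 0]. *)
Lemma polychain_above_top (Q : polychain K G d.+1) : poly_sum Q = [::].
Proof.
case E : (poly_sum Q) => [//|t s]; have [|+ _] := @poly_simplex _ _ _ _ _ Q t.
  by rewrite E mem_head.
by move=> /eqP h; have := rank_leq_col (simplex_edges t.2); rewrite h ltnn.
Qed.

Definition empty_polychain k : polychain K G k.
Proof. by exists [::] => // -[|?] [|?]. Defined.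

Lemma flat_norm_le P (F : formal_sum d G d) :
  same_chain P F -> (flat_norm K F <= poly_mass P)%E.
Proof.
move=> PF; apply: ereal_inf_lbound; exists (empty_polychain d.+1), P; split.
  by rewrite /fsub /boundary /= cats0.
by rewrite /poly_mass big_nil add0e.
Qed.

Lemma flat_norm_lt (F : formal_sum d G d) e : (flat_norm K F < e)%E ->
  exists P, same_chain P F /\ (poly_mass P < e)%E.
Proof.
move=> /ereal_inf_lt[_ [Q [P [PF ->]]] lt_e]; exists P; split.
  by move: PF; rewrite /boundary polychain_above_top /fsub /= cats0.
by move: lt_e; rewrite {1}/poly_mass polychain_above_top big_nil add0e.
Qed.

Lemma flat_norm_ge0 (F : formal_sum d G d) : (0 <= flat_norm K F)%E.
Proof.
apply: le_ereal_inf_tmp => _ [Q [P [_ ->]]].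
by rewrite adde_ge0 ?poly_mass_ge0.
Qed.

Lemma polychainD P Q : exists T : polychain K G d,
  same_chain T (poly_sum P ++ poly_sum Q) /\ (poly_mass T <= poly_mass P + poly_mass Q)%E.
Proof.
have [|T [TPQ mT]] := @polychain_exists (poly_sum P ++ poly_sum Q).
  by move=> t; rewrite mem_cat => /orP[]; exact: poly_simplex.
by exists T; split=> //; move: mT; rewrite /formal_mass big_cat.
Qed.

Definition pdist P Q : \bar R := flat_norm K (fsub P Q).

(** Strict bounds supply polyhedral representatives of the two differences; their sum represents
    [P - T]. *)
Lemma pdist_triangle_lt P Q T (a b : R) :
  (pdist P Q < a%:E)%E -> (pdist Q T < b%:E)%E -> (pdist P T < (a + b)%:E)%E.
Proof.
move=> /flat_norm_lt[S1 [e1 m1]] /flat_norm_lt[S2 [e2 m2]].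
have [S [eS mS]] := polychainD S1 S2.
have nPQ := proper_fsub (poly_proper P) (poly_proper Q).
have nQT := proper_fsub (poly_proper Q) (poly_proper T).
have nPT := proper_fsub (poly_proper P) (poly_proper T).
have nS1 := poly_proper S1; have nS2 := poly_proper S2.
have nS12 := proper_cat nS1 nS2; have nS := poly_proper S.
apply: le_lt_trans (_ : _ < _)%E; last first.
  by rewrite EFinD; exact: lteD m1 m2.
apply: le_trans mS; apply: flat_norm_le; apply: same_chain_trans eS _ => //.
have [|U hU] := @subdivides_all R d G [:: poly_sum S1; poly_sum S2; fsub P Q;
    fsub Q T; poly_sum S1 ++ poly_sum S2; fsub P T].
  by move=> F; rewrite !inE => /or4P[/eqP->|/eqP->|/eqP->|/or3P[] /eqP ->].
have h1 : subdivides U S1 by apply: hU; rewrite !inE eqxx.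
have h2 : subdivides U S2 by apply: hU; rewrite !inE eqxx ?orbT.
have h3 : subdivides U (fsub P Q) by apply: hU; rewrite !inE eqxx ?orbT.
have h4 : subdivides U (fsub Q T) by apply: hU; rewrite !inE eqxx ?orbT.
exists U; split; try by apply: hU; rewrite !inE eqxx ?orbT.
move=> tau tU; rewrite coef_cat (same_chain_coef e1 nS1 nPQ h1 h3 tU).
rewrite (same_chain_coef e2 nS2 nQT h2 h4 tU) !coef_fsub.
by rewrite addrA subrK.
Qed.

Lemma pdist_triangle P Q T (a b : R) :
  (pdist P Q <= a%:E)%E -> (pdist Q T <= b%:E)%E -> (pdist P T <= (a + b)%:E)%E.
Proof.
move=> h1 h2; apply/lee_addgt0Pr => e e0.
have e2 : 0 < e / 2 by rewrite divr_gt0.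
have lt c x : (x <= c%:E)%E -> (x < (c + e / 2)%:E)%E.
  by move=> /le_lt_trans; apply; rewrite lte_fin ltrDl.
apply: ltW; have := pdist_triangle_lt (lt _ _ h1) (lt _ _ h2).
by rewrite addrACA -splitr EFinD.
Qed.

Lemma pdist_sym P Q : pdist P Q = pdist Q P.
Proof.
suff h P1 Q1 : (pdist P1 Q1 <= pdist Q1 P1)%E by apply: le_anti; rewrite !h.
apply: le_ereal_inf_tmp => _ [Z [S [SP ->]]].
move: SP; rewrite /poly_mass (polychain_above_top Z) big_nil add0e /boundary /=.
rewrite /fsub /= cats0 -/(fsub Q1 P1) => SP.
have [|T [eT mT]] := @polychain_exists [seq (- t.1, t.2) | t <- poly_sum S].
  by move=> _ /mapP[t tS ->]; exact: (poly_simplex tS).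
have nP := poly_proper P1; have nQ := poly_proper Q1; have nS := poly_proper S.
have nPQ := proper_fsub nP nQ; have nQP := proper_fsub nQ nP.
have nN : proper_sum [seq (- t.1, t.2) | t <- poly_sum S].
  by move=> _ /mapP[t tS ->]; exact: (nS t tS).
apply: (@le_trans _ _ (poly_mass T)); last first.
  apply: le_trans mT _; rewrite /formal_mass big_map.
  by apply: lee_sum => t _; rewrite /= ng_normN.
apply: flat_norm_le; apply: same_chain_trans eT _ => //; first exact: poly_proper.
have [|U hU] := @subdivides_all R d G [:: poly_sum S; fsub Q1 P1;
    [seq (- t.1, t.2) | t <- poly_sum S]; fsub P1 Q1].
  by move=> F; rewrite !inE => /or4P[] /eqP ->.
have h1 : subdivides U S by apply: hU; rewrite !inE eqxx.
have h2 : subdivides U (fsub Q1 P1) by apply: hU; rewrite !inE eqxx ?orbT.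
exists U; split; try by apply: hU; rewrite !inE eqxx ?orbT.
move=> tau tU; rewrite coef_opp (same_chain_coef SP nS nQP h1 h2 tU).
by rewrite !coef_fsub opprB.
Qed.

Lemma pdist_same_chain P Q : same_chain P Q -> pdist P Q = 0%E.
Proof.
move=> PQ; apply: le_anti; rewrite flat_norm_ge0 andbT.
have -> : 0%E = poly_mass (empty_polychain d) by rewrite /poly_mass big_nil.
apply: flat_norm_le; have [U [SP SQ cPQ]] := PQ.
have [ndU nU cP] := SP; have [_ _ cQ] := SQ.
exists U; split.
- by split.
- split=> // t; rewrite mem_cat => /orP[/cP//|/mapP[s sQ ->]]; exact: (cQ s sQ).
- by move=> tau tU; rewrite coef_fsub cPQ // subrr /coef big_nil.
Qed.

Lemma pdist_refl P : pdist P P = 0%E.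
Proof.
apply: pdist_same_chain; have [|U hU] := @subdivides_all R d G [:: poly_sum P].
  by move=> F; rewrite inE => /eqP ->; exact: poly_proper.
by exists U; split=> //; apply: hU; rewrite inE.
Qed.

End TopDimension.
Arguments poly_proper {R d K G} P t _.

(** * Limits of extended real sequences in terms of real bounds *)

Section ExtendedLimits.
Context {R : realType}.
Implicit Types (f : nat -> \bar R) (e : R).

Lemma cvge0_lt f e : f @ \oo --> 0%E -> 0 < e ->
  exists N, forall n, (N <= n)%N -> (f n < e%:E)%E.
Proof.
move=> f0 e0; have : nbhs (0%:E : \bar R) [set x | (x < e%:E)%E].
  by rewrite /nbhs /=; apply: (filterS _ (lt_nbhsl e0)) => r; rewrite lte_fin.
by move=> /f0[N _ hN]; exists N.
Qed.

Lemma cvge0 f : (forall n, 0 <= f n)%E ->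
  (forall e, 0 < e -> exists N, forall n, (N <= n)%N -> (f n <= e%:E)%E) ->
  f @ \oo --> 0%E.
Proof.
move=> f0 fe; apply: limn_esup_le_cvg => //.
apply/lee_addgt0Pr => e e0; rewrite add0e; have [N hN] := fe e e0.
rewrite limn_esup_lim (cvg_lim _ (@cvg_esups_inf _ f)) //.
apply: ge_ereal_inf; exists (esups f N); first by exists N.
by apply: ge_ereal_sup => _ [n /= Nn <-]; exact: hN.
Qed.

Lemma limn_esup_lt f e : (limn_esup f < e%:E)%E ->
  exists N, forall n, (N <= n)%N -> (f n < e%:E)%E.
Proof.
rewrite limn_esup_lim (cvg_lim _ (@cvg_esups_inf _ f)) //.
move=> /ereal_inf_lt[_ [N _ <-] lt_e]; exists N => n Nn.
by apply: le_lt_trans lt_e; apply: ereal_sup_ubound; exists n.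
Qed.

Lemma limn_esup_le f e : (exists N, forall n, (N <= n)%N -> (f n <= e%:E)%E) ->
  (limn_esup f <= e%:E)%E.
Proof.
move=> [N hN]; rewrite limn_esup_lim (cvg_lim _ (@cvg_esups_inf _ f)) //.
apply: ge_ereal_inf; exists (esups f N); first by exists N.
by apply: ge_ereal_sup => _ [n /= Nn <-]; exact: hN.
Qed.

Lemma limn_einf_lty f : (limn_einf f < +oo)%E ->
  exists B : R, forall N, exists2 n, (N <= n)%N & (f n <= B%:E)%E.
Proof.
move=> fy; have [B lt_B] : exists B : R, (limn_einf f < B%:E)%E.
  move: fy; case: (limn_einf f) => [r _|//|_]; last by exists 0; rewrite ltNyr.
  by exists (r + 1); rewrite lte_fin ltrDl.
exists B => N; have : (einfs f N < B%:E)%E.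
  apply: le_lt_trans lt_B; rewrite limn_einf_lim (cvg_lim _ (@cvg_einfs_sup _ f)) //.
  by apply: ereal_sup_ubound; exists N.
by move=> /ereal_inf_lt[_ [n /= Nn <-] /ltW]; exists n.
Qed.

Lemma limn_einf_le f (B : \bar R) : (forall n, f n <= B)%E -> (limn_einf f <= B)%E.
Proof.
move=> fB; rewrite limn_einf_lim (cvg_lim _ (@cvg_einfs_sup _ f)) //.
apply: ge_ereal_sup => _ [n _ <-]; apply: ge_ereal_inf; exists (f n) => //.
by exists n => /=.
Qed.

Lemma half_expr_small (c e : R) : 0 < e ->
  exists N, forall n, (N <= n)%N -> c * (1 / 2) ^+ n < e.
Proof.
move=> e0; pose N := Num.truncn (`|c| / e).
have cN : `|c| / e < N.+1%:R by rewrite truncnS_gt.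
exists N.+1 => n Nn; apply: le_lt_trans (_ : `|c| * (1 / 2) ^+ n < e).
  by rewrite ler_wpM2r ?ler_norm // exprn_ge0.
rewrite div1r exprVn ltr_pdivrMr ?exprn_gt0 // mulrC -ltr_pdivrMr //.
apply: lt_le_trans cN _; rewrite -natrX ler_nat.
exact: leq_trans Nn (ltnW (ltn_expl _ _)).
Qed.

End ExtendedLimits.

(** * Flat chains as limits and chains of finite mass *)

Section FlatLimits.
Context {R : realType} {d : nat} {K : set 'rV[R]_d} {G : normedGroup R}.
Implicit Types (P Q : polychain K G d) (T : flat_chain K G d).
Implicit Types u v w : nat -> polychain K G d.

Definition asymptotic u v := forall e : R, 0 < e ->
  exists N, forall n, (N <= n)%N -> (pdist (u n) (v n) <= e%:E)%E.

Lemma asymptotic_sym u v : asymptotic u v -> asymptotic v u.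
Proof. by move=> uv e /uv[N hN]; exists N => n; rewrite pdist_sym; exact: hN. Qed.

Lemma asymptotic_trans u v w : asymptotic u v -> asymptotic v w -> asymptotic u w.
Proof.
move=> uv vw e e0; have e2 : 0 < e / 2 by rewrite divr_gt0.
have [N1 h1] := uv _ e2; have [N2 h2] := vw _ e2; exists (maxn N1 N2) => n.
rewrite geq_max => /andP[n1 n2]; rewrite [e]splitr.
exact: pdist_triangle (h1 n n1) (h2 n n2).
Qed.

Lemma flat_classP u v : flat_class u v <-> flat_cauchy v /\ asymptotic v u.
Proof.
split=> -[vC vu]; split=> //.
  move=> e e0; have [N hN] := cvge0_lt vu e0; exists N => n /hN; exact: ltW.
by apply: cvge0 => // n; exact: flat_norm_ge0.
Qed.

Lemma flat_class_refl u : flat_cauchy u -> flat_class u u.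
Proof.
move=> uC; apply/flat_classP; split=> // e e0; exists 0%N => n _.
by rewrite pdist_refl lee_fin ltW.
Qed.

Lemma flat_class_eq u v : asymptotic u v -> flat_class u = flat_class v.
Proof.
move=> uv; apply/seteqP; split=> w /flat_classP[wC wu]; apply/flat_classP; split=> //.
  exact: asymptotic_trans uv.
exact: asymptotic_trans (asymptotic_sym uv).
Qed.

Lemma flat_rep_set T : flat_set T = flat_class (flat_rep T).
Proof. by rewrite /flat_rep; case: cid => u []. Qed.

Lemma flat_rep_asymptotic T u : flat_set T = flat_class u -> asymptotic (flat_rep T) u.
Proof.
move=> Tu; have := flat_class_refl (flat_rep_cauchy T).
by rewrite -flat_rep_set Tu => /flat_classP[].
Qed.

Lemma flat_chain_eq T1 T2 : flat_set T1 = flat_set T2 -> T1 = T2.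
Proof.
case: T1 T2 => [s1 p1] [s2 p2] /= s12; rewrite {}s12 in p1 *.
by congr FlatChain; exact: Prop_irrelevance.
Qed.

(** Being within [e] of the flat chain, stated for an arbitrary representing sequence, whereas
    [flat_dist] is tied to the chosen [flat_rep]. *)
Definition near_limit u e P := exists N, forall m, (N <= m)%N -> (pdist P (u m) <= e%:E)%E.

Lemma near_limit_asymptotic u v P (a b : R) : asymptotic u v -> 0 < b ->
  near_limit u a P -> near_limit v (a + b) P.
Proof.
move=> uv b0 [N1 h1]; have [N2 h2] := uv _ b0; exists (maxn N1 N2) => m.
rewrite geq_max => /andP[m1 m2]; exact: pdist_triangle (h1 m m1) (h2 m m2).
Qed.

(** Unwinds the relaxation: a finite lower limit bounds the masses along arbitrarily late terms, and
    conversely approximations to precision [(1 / 2) ^+ n] form an admissible sequence. *)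
Lemma mass_ltyP T u : flat_set T = flat_class u -> (mass T < +oo)%E <->
  exists B : R, forall e, 0 < e -> exists P, near_limit u e P /\ (poly_mass P <= B%:E)%E.
Proof.
move=> /flat_rep_asymptotic Tu; split.
  move=> /ereal_inf_lt[_ [v /= vT <-] /limn_einf_lty[B vB]]; exists B => e e0.
  have e2 : 0 < e / 2 by rewrite divr_gt0.
  have [N1 h1] := cvge0_lt vT e2; have [n n1 hn] := vB N1.
  exists (v n); split=> //; rewrite [e]splitr; apply: near_limit_asymptotic Tu e2 _.
  have [N2 h2] := limn_esup_lt (h1 n n1); exists N2 => m /h2; exact: ltW.
move=> [B hB].
have /choice[v vP] (n : nat) : exists P,
    near_limit u ((1 / 2) ^+ n) P /\ (poly_mass P <= B%:E)%E.
  by apply: hB; rewrite exprn_gt0.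
apply: (@le_lt_trans _ _ B%:E); last exact: ltry.
apply: ge_ereal_inf; exists (limn_einf (fun n => poly_mass (v n))); last first.
  by apply: limn_einf_le => n; have [] := vP n.
exists v => //=; apply: cvge0.
  move=> n; apply: le_trans (limn_einf_sup _).
  rewrite limn_einf_lim (cvg_lim _ (@cvg_einfs_sup _ _)) //.
  apply: le_ereal_sup_tmp; eexists; first by exists 0%N.
  by apply: le_ereal_inf_tmp => _ [m _ <-]; exact: flat_norm_ge0.
move=> e e0; have e2 : 0 < e / 2 by rewrite divr_gt0.
have [N hN] := half_expr_small 1 e2; exists N => n Nn; apply: limn_esup_le.
rewrite [e]splitr; apply: near_limit_asymptotic (asymptotic_sym Tu) e2 _.
have [[M hM] _] := vP n; exists M => m /hM /le_trans; apply.
by rewrite lee_fin ltW // -[X in X < _]mul1r; exact: hN.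
Qed.

End FlatLimits.

(** * Lifting chains along [phi] *)

Section Lifting.
Context {R : realType} {d : nat} {K : set 'rV[R]_d} {G' G : normedGroup R}.
Context {phi : {additive G' -> G}} {C : R}.
Hypotheses (C_gt0 : 0 < C) (phi_surj : set_surj [set: G'] [set: G] phi).
Hypothesis phi_le : forall g' : G', ng_norm (phi g') <= C * ng_norm g'.
Hypothesis phi_ge : forall g : G,
  C^-1 * inf [set ng_norm g' | g' in phi @^-1` [set g]] <= ng_norm g.

(* Choosing 0 over 0 makes a fixed factor 2 suffice. *)
Lemma lift_exists (g : G) : exists g', phi g' = g /\ ng_norm g' <= 2 * C * ng_norm g.
Proof.
have [->|/eqP g0] := pselect (g = 0).
  by exists 0; rewrite raddf0 !ng_norm0 mulr0.
have gn0 : 0 < ng_norm g.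
  rewrite lt0r ng_norm_ge0 andbT; apply/eqP => /ng_norm_eq0 gE.
  by rewrite gE eqxx in g0.
pose E := [set ng_norm g' | g' in phi @^-1` [set g]].
have infE : has_inf E.
  split; last by exists 0 => _ [g' _ <-]; exact: ng_norm_ge0.
  by have [g' _ pg] := phi_surj (I : [set: G] g); exists (ng_norm g'), g'.
have lt_inf : inf E < 2 * C * ng_norm g.
  have := phi_ge g; rewrite ler_pdivrMl // => h; apply: le_lt_trans h _.
  by have := mulr_gt0 C_gt0 gn0; lra.
have e0 : 0 < 2 * C * ng_norm g - inf E by rewrite subr_gt0.
have [_ [g' pg <-]] := inf_adherent e0 infE.
by rewrite addrC subrK => /ltW; exists g'.
Qed.

(** Only coefficients change, so the image of the lift is literally the same formal sum and masses
    compare term by term. *)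
Lemma polychain_lift (P : polychain K G d) : exists P' : polychain K G' d,
  poly_sum (poly_map phi P') = poly_sum P /\
  (poly_mass P' <= (2 * C)%:E * poly_mass P)%E.
Proof.
have [l lP] := choice lift_exists.
pose F : formal_sum (R := R) d G' d := [seq (l t.1, t.2) | t <- poly_sum P].
have FK t : t \in F -> nondegenerate t.2 /\ simplex_hull t.2 `<=` K.
  by move=> /mapP[s sP ->]; exact: (poly_simplex sP).
have F2 : nonoverlapping [seq t.2 | t <- F].
  by rewrite -map_comp -[map _ _]/(map snd _); exact: poly_nonoverlapping.
exists (Polychain FK F2); split.
  rewrite /= /formal_map -map_comp -[RHS]map_id; apply: eq_map => -[g s] /=.
  by have [-> _] := lP g.
rewrite /poly_mass /= big_map ge0_sume_distrr; last first.
  by move=> t _; rewrite mule_ge0 ?hausdorff_ge0 // lee_fin ng_norm_ge0.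
apply: lee_sum => t _ /=; rewrite muleA -EFinM; apply: lee_wpmul2r.
  exact: hausdorff_ge0.
by rewrite lee_fin; have [] := lP t.1.
Qed.

Lemma pdist_poly_map (P Q : polychain K G' d) (a : R) :
  (pdist P Q <= a%:E)%E -> (pdist (poly_map phi P) (poly_map phi Q) <= (C * a)%:E)%E.
Proof.
move=> PQ; have := @flat_norm_formal_map _ _ K _ _ _ _ C_gt0 phi_le _ (fsub P Q).
rewrite formal_map_fsub => /le_trans; apply; rewrite EFinM.
by apply: lee_wpmul2l => //; rewrite lee_fin ltW.
Qed.

Lemma asymptotic_poly_map (u v : nat -> polychain K G' d) : asymptotic u v ->
  asymptotic (fun n => poly_map phi (u n)) (fun n => poly_map phi (v n)).
Proof.
move=> uv e e0; have Ce0 : 0 < C^-1 * e by rewrite mulr_gt0 ?invr_gt0.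
have [N hN] := uv _ Ce0; exists N => n /hN /pdist_poly_map.
by rewrite mulrA mulfV ?mul1r // gt_eqF.
Qed.

Lemma flat_map_set (T' : flat_chain K G' d) : flat_set (flat_map C_gt0 phi_le T') =
  flat_class (fun n => poly_map phi (flat_rep T' n)).
Proof. by []. Qed.

Lemma flat_map_mass (T' : flat_chain K G' d) :
  (mass T' < +oo)%E -> (mass (flat_map C_gt0 phi_le T') < +oo)%E.
Proof.
move=> /(mass_ltyP (flat_rep_set T'))[B hB].
apply/(mass_ltyP (flat_map_set T')); exists (C * B) => e e0.
have Ce0 : 0 < C^-1 * e by rewrite mulr_gt0 ?invr_gt0.
have [P [[N hN] mP]] := hB _ Ce0; exists (poly_map phi P); split.
  exists N => m /hN /pdist_poly_map.
  by rewrite mulrA mulfV ?mul1r // gt_eqF.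
apply: le_trans (poly_map_mass phi_le P) _; rewrite EFinM.
by apply: lee_wpmul2l => //; rewrite lee_fin ltW.
Qed.

Lemma geometric_near (G0 : normedGroup R) (u : nat -> polychain K G0 d) (c : R) :
  0 <= c -> (forall n, (pdist (u n.+1) (u n) <= (c * (1 / 2) ^+ n)%:E)%E) ->
  forall n m, (n <= m)%N -> (pdist (u m) (u n) <= (2 * c * (1 / 2) ^+ n)%:E)%E.
Proof.
move=> c0 h n m /subnK <-; move: (m - n)%N => {}m.
(* The exact partial geometric sum is what the induction can carry. *)
apply: (@le_trans _ _ (2 * c * ((1 / 2) ^+ n - (1 / 2) ^+ (m + n)))%:E).
  elim: m => [|m ih]; first by rewrite add0n subrr mulr0 pdist_refl.
  apply: le_trans (pdist_triangle (h (m + n)%N) ih) _.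
  rewrite lee_fin addSn exprS; set p := _ ^+ (m + n); lra.
rewrite lee_fin ler_wpM2l ?mulr_ge0 // gerBl.
by rewrite exprn_ge0.
Qed.

Lemma geometric_cauchy (G0 : normedGroup R) (u : nat -> polychain K G0 d) (c : R) :
  0 <= c -> (forall n, (pdist (u n.+1) (u n) <= (c * (1 / 2) ^+ n)%:E)%E) ->
  flat_cauchy u.
Proof.
move=> c0 h e e0; have [N hN] := half_expr_small (4 * c) e0; exists N => m n Nm Nn.
have hm := geometric_near c0 h Nm; have hn := geometric_near c0 h Nn.
rewrite pdist_sym in hn; have := pdist_triangle hm hn => /le_lt_trans; apply.
by rewrite lte_fin; apply: le_lt_trans (hN N (leqnn N)); lra.
Qed.

(** Increments, not the [w n] themselves, are lifted, so that consecutive [u n] stay close. The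
    factor [2 * C] of [polychain_lift] turns [2 * (1 / 2) ^+ n] into [4 * C * (1 / 2) ^+ n], and
    these bounds sum to [8 * C]. *)
Lemma lift_sequence (w : nat -> polychain K G d) (B : R) :
  (poly_mass (w 0%N) <= B%:E)%E ->
  (forall n, (pdist (w n.+1) (w n) < (2 * (1 / 2) ^+ n)%:E)%E) ->
  exists u : nat -> polychain K G' d,
  [/\ forall n, same_chain (poly_map phi (u n)) (w n),
      forall n, (poly_mass (u n) <= (2 * C * B + 8 * C)%:E)%E &
      forall n, (pdist (u n.+1) (u n) <= (4 * C * (1 / 2) ^+ n)%:E)%E].
Proof.
move=> mw0 dw.
have /choice[p pP] n : exists p' : polychain K G' d,
    same_chain (poly_map phi p') (fsub (w n.+1) (w n)) /\
    (poly_mass p' <= (4 * C * (1 / 2) ^+ n)%:E)%E.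
  have [q [qw mq]] := flat_norm_lt (dw n); have [q' [q'q mq']] := polychain_lift q.
  exists q'; rewrite q'q; split=> //; apply: le_trans mq' _.
  apply: le_trans (lee_wpmul2l _ (ltW mq)) _.
    by rewrite lee_fin mulr_ge0 // ltW.
  by rewrite -EFinM lee_fin; lra.
have [u0 [u0w mu0]] := polychain_lift (w 0%N).
have /choice[add addP] (PQ : polychain K G' d * polychain K G' d) := polychainD PQ.1 PQ.2.
pose u := fix u n := if n is m.+1 then add (u m, p m) else u0.
have uS n : same_chain (u n.+1) (poly_sum (u n) ++ poly_sum (p n)) by have [] := addP (u n, p n).
have mS n : (poly_mass (u n.+1) <= poly_mass (u n) + poly_mass (p n))%E.
  by have [] := addP (u n, p n).
have np n := poly_proper (p n); have nu n := poly_proper (u n).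
have nw n := poly_proper (w n).
have nphi (P : polychain K G' d) : proper_sum (formal_map phi P) := poly_proper (poly_map phi P).
have nw' n := proper_fsub (nw n.+1) (nw n).
exists u; split.
- elim=> [|n ih].
    rewrite u0w; have [|U hU] := @subdivides_all R d G [:: poly_sum (w 0%N)].
      by move=> F; rewrite inE => /eqP ->.
    by exists U; split=> //; apply: hU; rewrite inE.
  have nc : proper_sum (formal_map phi (poly_sum (u n) ++ poly_sum (p n))).
    by move=> _ /mapP[t /(proper_cat (nu n) (np n)) h ->].
  apply: same_chain_trans (same_chain_formal_map phi (uS n)) _ => //.
  have [pw _] := pP n.
  have [|U hU] := @subdivides_all R d G [:: formal_map phi (poly_sum (u n) ++ poly_sum (p n));
      poly_sum (poly_map phi (u n)); poly_sum (poly_map phi (p n)); poly_sum (w n);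
      fsub (w n.+1) (w n); poly_sum (w n.+1)].
    move=> F; rewrite !inE => /or4P[/eqP->|/eqP->|/eqP->|/or3P[] /eqP ->];
      first [by []|exact: nphi].
  have h1 : subdivides U (poly_map phi (u n)) by apply: hU; rewrite !inE eqxx ?orbT.
  have h2 : subdivides U (poly_map phi (p n)) by apply: hU; rewrite !inE eqxx ?orbT.
  have h3 : subdivides U (w n) by apply: hU; rewrite !inE eqxx ?orbT.
  have h4 : subdivides U (fsub (w n.+1) (w n)) by apply: hU; rewrite !inE eqxx ?orbT.
  exists U; split; try by apply: hU; rewrite !inE eqxx ?orbT.
  move=> tau tU; rewrite /formal_map map_cat coef_cat.
  rewrite (same_chain_coef ih (nphi _) (nw n) h1 h3 tU).
  rewrite (same_chain_coef pw (nphi _) (nw' n) h2 h4 tU) coef_fsub.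
  by rewrite addrC subrK.
(* The mass bound is proved with the partial sum of the series, so that the induction closes. *)
- move=> n; apply: (@le_trans _ _ (2 * C * B + 8 * C * (1 - (1 / 2) ^+ n))%:E); last first.
    have q0 : 0 <= (1 / 2) ^+ n :> R by rewrite exprn_ge0.
    by have := mulr_ge0 (ltW C_gt0) q0; rewrite lee_fin; lra.
  elim: n => [|n ih].
    rewrite expr0 subrr mulr0 addr0; apply: le_trans mu0 _.
    rewrite (EFinM (2 * C)).
    by apply: lee_wpmul2l => //; rewrite lee_fin mulr_ge0 // ltW.
  apply: le_trans (mS n) _; have [_ mp] := pP n.
  apply: le_trans (leeD ih mp) _; rewrite -EFinD lee_fin exprS.
  by set q := _ ^+ n; lra.
- move=> n; have [_ mp] := pP n; apply: le_trans mp; apply: flat_norm_le.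
  have nu' := proper_fsub (nu n.+1) (nu n).
  have nup := proper_cat (nu n) (np n).
  have [|U hU] := @subdivides_all R d G' [:: poly_sum (u n.+1); poly_sum (u n);
      poly_sum (p n); poly_sum (u n) ++ poly_sum (p n); fsub (u n.+1) (u n)].
    by move=> F; rewrite !inE => /or4P[/eqP->|/eqP->|/eqP->|/orP[] /eqP ->].
  have h1 : subdivides U (u n.+1) by apply: hU; rewrite !inE eqxx ?orbT.
  have h2 : subdivides U (poly_sum (u n) ++ poly_sum (p n)).
    by apply: hU; rewrite !inE eqxx ?orbT.
  exists U; split; try by apply: hU; rewrite !inE eqxx ?orbT.
  move=> tau tU; rewrite coef_fsub (same_chain_coef (uS n) (nu _) nup h1 h2 tU).
  by rewrite coef_cat addrAC subrr add0r.
Qed.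

Lemma flat_map_surj (T : flat_chain K G d) : (mass T < +oo)%E ->
  exists2 T' : flat_chain K G' d, (mass T' < +oo)%E & flat_map C_gt0 phi_le T' = T.
Proof.
move=> /(mass_ltyP (flat_rep_set T))[B hB].
have half0 n : 0 < (1 / 2) ^+ n :> R by rewrite exprn_gt0.
have /choice[w wP] (n : nat) : exists P, near_limit (flat_rep T) ((1 / 2) ^+ n.+1) P /\
    (poly_mass P <= B%:E)%E by exact: hB.
(* The two precisions sum to three quarters of [(1 / 2) ^+ n]; the slack gives the strict
   inequality. *)
have dw n : (pdist (w n.+1) (w n) < (2 * (1 / 2) ^+ n)%:E)%E.
  have [[N1 h1] _] := wP n.+1; have [[N2 h2] _] := wP n.
  have m1 := h1 _ (leq_maxl N1 N2); have m2 := h2 _ (leq_maxr N1 N2).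
  rewrite pdist_sym in m2; apply: le_lt_trans (pdist_triangle m1 m2) _.
  by rewrite lte_fin !exprS; have := half0 n; lra.
have [u [uw mu du]] := lift_sequence (wP 0%N).2 dw.
have C4 : 0 <= 4 * C by rewrite mulr_ge0 // ltW.
have uC := geometric_cauchy C4 du.
pose T' : flat_chain K G' d := FlatChain (ex_intro _ u (conj uC erefl)).
have T'u : flat_set T' = flat_class u by [].
exists T'.
  (* The terms of [u] are themselves approximations of bounded mass. *)
  apply/(mass_ltyP T'u); exists (2 * C * B + 8 * C) => e e0.
  have [N hN] := uC e e0; exists (u N); split=> //; exists N => m Nm.
  by apply: ltW; exact: hN.
(* The images of the chosen representative of [T'] are asymptotic to those of [u], these to [w], and
   [w] to the representative of [T]. *)
apply: flat_chain_eq; rewrite flat_map_set flat_rep_set; apply: flat_class_eq.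
apply: asymptotic_trans (asymptotic_poly_map (flat_rep_asymptotic T'u)) _.
apply: (@asymptotic_trans _ _ _ _ _ w).
  by move=> e e0; exists 0%N => n _; rewrite pdist_same_chain // lee_fin ltW.
move=> e e0; have e2 : 0 < e / 2 by rewrite divr_gt0.
have [N1 h1] := half_expr_small 1 e2; have [N2 h2] := flat_rep_cauchy T e2.
exists (maxn N1 N2) => n; rewrite geq_max => /andP[n1 n2].
have [[N3 h3] _] := wP n; have m3 := h3 _ (leq_maxl N3 N2).
have m2 := h2 _ n (leq_maxr N3 N2) n2.
apply: le_trans (pdist_triangle m3 (ltW m2)) _.
rewrite [X in (_ <= X%:E)%E]splitr lee_fin lerD2r ltW // -[X in X < _]mul1r.
exact: h1 _ (leq_trans n1 (leqnSn n)).
Qed.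

End Lifting.

Theorem corollary5p2 (R : realType) (d : nat) (G' G : normedGroup R)
  (phi : {additive G' -> G}) (C : R) (C_gt0 : 0 < C)
  (phi_surj : set_surj [set: G'] [set: G] phi)
  (phi_le : forall g' : G', ng_norm (phi g') <= C * ng_norm g')
  (phi_ge : forall g : G,
     C^-1 * inf [set ng_norm g' | g' in phi @^-1` [set g]] <= ng_norm g)
  (K : set 'rV[R]_d)
  (K_convex : convex_set (K : set (convex_lmodType 'rV[R]_d)))
  (K_compact : compact K) (K_interior : interior K !=set0) :
  let pi : flat_chain K G' d -> flat_chain K G d := flat_map C_gt0 phi_le in
  let finite_mass' := [set T' : flat_chain K G' d | (mass T' < +oo)%E] in
  let finite_mass := [set T : flat_chain K G d | (mass T < +oo)%E] in
  set_fun finite_mass' finite_mass pi /\ set_surj finite_mass' finite_mass pi.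
Proof.
split=> [T' T'm|T Tm]; first exact: flat_map_mass.
by have [T' T'm <-] := flat_map_surj C_gt0 phi_surj phi_le phi_ge Tm; exists T'.
Qed.
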